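(* Let $S$ be a Haydon space. Then the Banach space $C(S)$ is $1$-Grothendieck. (Here $C(S)$ denotes either the real space $C(S;\mathbb{R})$ or the complex space $C(S;\mathbb{C})$; the assertion holds for both.)
   Context: For a compact space $K$, $C(K;\mathbb{R})$ and $C(K;\mathbb{C})$ denote the Banach spaces of continuous real-valued (respectively complex-valued) functions on $K$ with the supremum norm. A topological space is called totally disconnected if it contains at least two different points and each two different points are separated by a clopen set (i.e. for $x\neq y$ there is a clopen set containing $x$ but not $y$). A totally disconnected compact space $K$ is called a Haydon space if the algebra of its clopen subsets has the Subsequential completeness property (SCP): for every sequence $(U_n)_{n\in\mathbb{N}}$ of pairwise disjoint clopen subsets of $K$ there is an infinite set $M\subset\mathbb{N}$ such that the closure of $\bigcup_{m\in M}U_m$ is open. For a Banach space $X$ (real or complex), $B_X$ denotes its closed unit ball, $X^{\ast}$ its dual and $X^{\ast\ast}$ its bidual. For a sequence $(a_n)$ of scalars, $\mathrm{clust}(a_n)$ is the set of all its cluster points. For a bounded sequence $(x_n^{\ast})_{n\in\mathbb{N}}$ in $X^{\ast}$ put $$\delta_{w^{\ast}}(x_n^{\ast}):=\sup\{\mathrm{diam}\,\mathrm{clust}(x_n^{\ast}(x)) : x\in B_X\},\qquad \delta_{w}(x_n^{\ast}):=\sup\{\mathrm{diam}\,\mathrm{clust}(x^{\ast\ast}(x_n^{\ast})) : x^{\ast\ast}\in B_{X^{\ast\ast}}\}.$$ For $c\geq 1$, $X$ is called $c$-Grothendieck if $\delta_w(x_n^{\ast})\leq c\,\delta_{w^{\ast}}(x_n^{\ast})$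 for every bounded sequence $(x_n^{\ast})_{n\in\mathbb{N}}$ in $X^{\ast}$. *)

(* Defs.v *)
From HB Require Import structures.
From mathcomp Require Import all_boot all_order all_algebra.
From mathcomp Require Import complex.
From mathcomp Require Import all_classical all_reals all_analysis.

Set Implicit Arguments.
Unset Strict Implicit.
Unset Printing Implicit Defensive.

Import Order.TTheory GRing.Theory Num.Theory.
Import numFieldNormedType.Exports.

Local Open Scope classical_set_scope.
Local Open Scope ring_scope.

(* The scalar field K is either a realType R or its complex closure R[i]. As
   everywhere in MathComp, norms take values in K itself; the order of R[i] is
   partial (x <= y iff y - x is a nonnegative real), so that all comparable
   families of scalars lie on a translate of the real line. Least upper bounds
   are taken with the library's [supremum 0]; [order_complete] states that
   these are genuine for nonempty bounded sets, and holds for R and R[i]. *)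
Definition order_complete (K : numFieldType) : Prop :=
  forall A : set K, A !=set0 -> has_ubound A -> supremums A !=set0.

Lemma supremumsP (K : numFieldType) (cK : order_complete K) (A : set K) :
  A !=set0 -> has_ubound A -> supremums A (supremum 0 A).
Proof.
move=> A0 Aub; have [s As] := cK A A0 Aub.
rewrite /supremum; case: ifPn => [/eqP A00|_].
  by move: A0; rewrite A00 => -[].
exact: (xgetPex 0 (cK A A0 Aub)).
Qed.

Lemma real_order_complete (R : realType) : order_complete R.
Proof.
move=> A A0 Aub; have hA : has_sup A by [].
exists (sup A); split; first exact: sup_upper_bound.
by move=> x Ax; exact: ge_sup.
Qed.

Lemma complex_order_complete (R : realType) : order_complete R[i].
Proof.
move=> A [a Aa] [u Au].
have Im_ub x y : ubound A x -> A y -> complex.Im y = complex.Im x.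
  by move=> Ax Ay; have := Ax _ Ay; rewrite lecE => /andP[/eqP].
have Re_ub x y : ubound A x -> A y -> complex.Re y <= complex.Re x.
  by move=> Ax Ay; have := Ax _ Ay; rewrite lecE => /andP[].
have [s [sub slb]] : supremums (@complex.Re R @` A) !=set0.
  apply: real_order_complete; first by exists (complex.Re a), a.
  by exists (complex.Re u) => _ [y Ay <-]; exact: Re_ub.
exists (Complex s (complex.Im a)); split.
  move=> x Ax; rewrite lecE/= (Im_ub u x)// -(Im_ub u a)// eqxx/=.
  by apply: sub; exists x.
move=> x Ax; rewrite lecE/= (Im_ub x a)// eqxx/=.
by apply: slb => _ [y Ay <-]; exact: Re_ub.
Qed.

Definition closed_unit_ball (K : numFieldType) (V : normedModType K) : set V :=
  [set x | `|x| <= 1].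
Arguments closed_unit_ball {K} V.

Definition continuous_linear (K : numFieldType) (X : normedModType K) :
  {pred X -> K^o} := mem [set f | linear f /\ continuous f].

(* [cK] does not occur in the carrier; it is a parameter of the type so that
   the operator norm, which is only a norm thanks to [cK], can be its canonical
   norm. The same goes for [cK] and [cS] in [cspace] below. *)
Record dual (K : numFieldType) (cK : order_complete K) (X : normedModType K) :
    Type := Dual {
  functional :> X -> K^o ;
  _ : functional \in @continuous_linear K X }.

Section dual_space.
Variables (K : numFieldType) (cK : order_complete K) (X : normedModType K).
Notation dual := (dual cK X).
Notation continuous_linear := (@continuous_linear K X).

HB.instance Definition _ := [isSub for @functional K cK X].
HB.instance Definition _ := [Choice of dual by <:].

Lemma continuous_linear_submod_closed : submod_closed continuous_linear.
Proof.
split.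
  rewrite inE/=; split; last by move=> x; exact: cvg_cst.
  by move=> a x y /=; rewrite scaler0 addr0.
move=> a f g; rewrite !inE/= => -[lf cf] [lg cg]; split.
  move=> b x y /=.
  rewrite -[LHS]/(a *: f (b *: x + y) + g (b *: x + y)).
  rewrite -[RHS]/(b *: (a *: f x + g x) + (a *: f y + g y)).
  by rewrite lf lg !scalerDr !scalerA [a * b]mulrC addrACA.
move=> x; apply: (@cvgD _ _ _ _ _ (a *: f) g); last exact: cg.
by apply: cvgZr; exact: cf.
Qed.

HB.instance Definition _ := GRing.isSubmodClosed.Build _ _ continuous_linear
  continuous_linear_submod_closed.
HB.instance Definition _ := [SubChoice_isSubLmodule of dual by <:].

Implicit Types f g : dual.

Lemma functional_linear f : linear f.
Proof. by case: f => f /=; rewrite inE => -[]. Qed.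

Lemma functional_continuous f : continuous f.
Proof. by case: f => f /=; rewrite inE => -[]. Qed.

HB.instance Definition _ (f : dual) :=
  GRing.isLinear.Build K X K^o *:%R (@functional K cK X f) (functional_linear f).

Definition dual_norm f : K :=
  supremum 0 [set `|f x| | x in closed_unit_ball X].

Let img f := [set `|f x| | x in closed_unit_ball X].

Let img0 f : img f !=set0.
Proof. by exists `|f 0|, 0 => //=; rewrite /closed_unit_ball/= normr0. Qed.

Let img_ub f : has_ubound (img f).
Proof.
have /linear_bounded_continuous/bounded_funP/(_ 1)[M fM] :=
  @functional_continuous f.
by exists M => _ [x x1 <-]; exact: fM.
Qed.

Lemma dual_norm_ge f x : `|x| <= 1 -> `|f x| <= dual_norm f.
Proof.
by move=> x1; apply: (supremumsP cK (img0 f) (img_ub f)).1; exists x.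
Qed.

Lemma dual_norm_le f M :
  (forall x, `|x| <= 1 -> `|f x| <= M) -> dual_norm f <= M.
Proof.
move=> fM; apply: (supremumsP cK (img0 f) (img_ub f)).2 => _ [x x1 <-].
exact: fM.
Qed.

Let dual_norm_ge0 f : 0 <= dual_norm f.
Proof. by apply: le_trans (@dual_norm_ge f 0 _); rewrite ?normr0. Qed.

Lemma dual_normD f g : dual_norm (f + g) <= dual_norm f + dual_norm g.
Proof.
apply: dual_norm_le => x x1; apply: le_trans (ler_normD (f x) (g x)) _.
by rewrite lerD// dual_norm_ge.
Qed.

Lemma dual_normZ a f : dual_norm (a *: f) = `|a| * dual_norm f.
Proof.
have le b h : dual_norm (b *: h) <= `|b| * dual_norm h.
  apply: dual_norm_le => x x1.
  rewrite -[(b *: h) x]/(b * h x) normrM ler_wpM2l//.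
  exact: dual_norm_ge.
apply/le_anti; rewrite le/=.
have [->|a0] := eqVneq a 0; first by rewrite normr0 mul0r.
rewrite -{1}[f](@scalerK _ _ a) ?unitfE// -ler_pdivlMl ?normr_gt0//.
by rewrite -normfV le.
Qed.

Lemma dual_norm0_eq0 f : dual_norm f = 0 -> f = 0.
Proof.
move=> f0; apply/val_inj/funext => x /=; apply/eqP.
have [->|x0] := eqVneq x 0; first by rewrite linear0.
have : `|f (`|x|^-1 *: x)| <= 0 by rewrite -f0 dual_norm_ge// normfZV.
by rewrite normr_le0 linearZ/= scaler_eq0 invr_eq0 normr_eq0 (negbTE x0).
Qed.

HB.instance Definition _ :=
  Lmodule_isNormed.Build K dual dual_normD dual_normZ dual_norm0_eq0.

End dual_space.

Definition cspace (K : numFieldType) (cK : order_complete K)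
  (S : topologicalType) (cS : compact [set: S]) : Type := continuousType S K^o.

Section continuous_functions.
Variables (K : numFieldType) (cK : order_complete K).
Variables (S : topologicalType) (cS : compact [set: S]).
Notation cspace := (cspace cK cS).

HB.instance Definition _ := Choice.copy cspace (continuousType S K^o).

Definition cts_pred : {pred S -> K^o} := mem [set f | continuous f].

Definition cts_val (f : cspace) : S -> K^o := f.

Definition cts_Sub (f : S -> K^o) (fP : f \in cts_pred) : cspace :=
  mkcts (set_mem fP).

Lemma cts_rect (P : cspace -> Type) :
  (forall f (fP : f \in cts_pred), P (cts_Sub fP)) -> forall u, P u.
Proof.
move=> Psub [f [[fc]]]; have fP : f \in cts_pred by rewrite inE.
have -> : fc = set_mem fP by exact: Prop_irrelevance.
exact: Psub.
Qed.

Lemma cts_SubK f (fP : f \in cts_pred) : cts_val (cts_Sub fP) = f.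
Proof. by []. Qed.

HB.instance Definition _ := isSub.Build _ _ cspace cts_rect cts_SubK.

Lemma cts_submod_closed : submod_closed cts_pred.
Proof.
split; first by rewrite inE/= => x; exact: cvg_cst.
move=> a f g; rewrite !inE/= => cf cg x.
by apply: (@cvgD _ _ _ _ _ (a *: f) g); [apply: cvgZr; exact: cf|exact: cg].
Qed.

HB.instance Definition _ := GRing.isSubmodClosed.Build _ _ cts_pred
  cts_submod_closed.
HB.instance Definition _ := [SubChoice_isSubLmodule of cspace by <:].

Implicit Types f g : cspace.

Definition sup_norm f : K := supremum 0 [set `|f x| | x in setT].

Let sup_norm_spec f :
  [/\ 0 <= sup_norm f, forall x, `|f x| <= sup_norm f &
      forall M, 0 <= M -> (forall x, `|f x| <= M) -> sup_norm f <= M].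
Proof.
set A := [set `|f x| | x in setT].
have [[x _]|S0] := pselect ([set: S] !=set0); last first.
  have A0 : A = set0.
    by apply/seteqP; split=> // k [x _ _]; case: S0; exists x.
  rewrite /sup_norm -/A A0 /supremum eqxx; split => // x.
  by case: S0; exists x.
have Aub : has_ubound A.
  have [|M0 [M0r fM]] :=
      (compact_near_coveringP _).1 cS K +oo (fun M x => `|f x| <= M) _.
  - move=> y _; exists ([set z | `|f z - f y| < 1], [set M | `|f y| + 1 <= M]).
      split=> /=; last by apply: nbhs_pinfty_ge; rewrite ger0_real ?addr_ge0.
      have /cvgrPdistC_lt : f z @[z --> y] --> f y by exact: cts_fun.
      exact.
    move=> [z M] /= [zy yM]; apply: le_trans yM.
    rewrite -[f z](subrK (f y)) (le_trans (ler_normD _ _))// addrC lerD2l.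
    exact: ltW.
  by exists (M0 + 1) => _ [y _ <-]; apply: fM => //; rewrite ltrDl.
have An0 : A !=set0 by exists `|f x|, x.
have [ub lb] := supremumsP cK An0 Aub.
have le y : `|f y| <= sup_norm f by apply: ub; exists y.
split => //; first exact: le_trans (le x).
by move=> M _ fM; apply: lb => _ [y _ <-].
Qed.

Lemma sup_norm_ge f x : `|f x| <= sup_norm f.
Proof. by have [] := sup_norm_spec f. Qed.

Lemma sup_norm_le f M : 0 <= M -> (forall x, `|f x| <= M) -> sup_norm f <= M.
Proof. by have [_ _] := sup_norm_spec f; apply. Qed.

Let sup_norm_ge0 f : 0 <= sup_norm f.
Proof. by have [] := sup_norm_spec f. Qed.

Lemma sup_normD f g : sup_norm (f + g) <= sup_norm f + sup_norm g.
Proof.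
apply: sup_norm_le => [|x]; first exact: addr_ge0.
by apply: le_trans (ler_normD (f x) (g x)) _; rewrite lerD// sup_norm_ge.
Qed.

Lemma sup_normZ a f : sup_norm (a *: f) = `|a| * sup_norm f.
Proof.
have le b h : sup_norm (b *: h) <= `|b| * sup_norm h.
  apply: sup_norm_le => [|x]; first exact: mulr_ge0.
  by rewrite -[(b *: h) x]/(b * h x) normrM ler_wpM2l// sup_norm_ge.
apply/le_anti; rewrite le/=.
have [->|a0] := eqVneq a 0; first by rewrite normr0 mul0r.
rewrite -{1}[f](@scalerK _ _ a) ?unitfE// -ler_pdivlMl ?normr_gt0//.
by rewrite -normfV le.
Qed.

Lemma sup_norm0_eq0 f : sup_norm f = 0 -> f = 0.
Proof.
move=> f0; apply/val_inj/funext => x; apply/eqP.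
by rewrite -normr_le0 -f0; exact: sup_norm_ge.
Qed.

HB.instance Definition _ :=
  Lmodule_isNormed.Build K cspace sup_normD sup_normZ sup_norm0_eq0.

End continuous_functions.

(* For a bounded sequence [xs] all the sets below are bounded, so that their
   suprema are genuine by [supremumsP]. *)
Section Grothendieck.
Variables (K : numFieldType) (cK : order_complete K) (X : normedModType K).

Definition diam (A : set K) : K :=
  supremum 0 [set `|p.1 - p.2| | p in A `*` A].

Definition clust (a : nat -> K) : set K := cluster (a n @[n --> \oo]).

Definition delta_wstar (xs : nat -> dual cK X) : K :=
  supremum 0 [set diam (clust (fun n => xs n x)) | x in closed_unit_ball X].

Definition delta_w (xs : nat -> dual cK X) : K :=
  supremum 0 [set diam (clust (fun n => F (xs n)))
             | F in closed_unit_ball (dual cK (dual cK X))].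

Definition grothendieck (c : K) : Prop :=
  1 <= c /\
  forall xs : nat -> dual cK X, bounded_fun xs ->
    delta_w xs <= c * delta_wstar xs.

End Grothendieck.

(* [zero_dimensional] is the separation of distinct points by clopen sets; the
   library's [totally_disconnected] is about connected components instead. *)
Record haydon_space (S : topologicalType) : Prop := {
  haydon_compact : compact [set: S] ;
  haydon_two_points : exists x y : S, x != y ;
  haydon_separated : zero_dimensional S ;
  haydon_SCP : forall U : nat -> set S,
    (forall n, clopen (U n)) -> trivIset setT U ->
    exists2 M : set nat, infinite_set M & open (closure (\bigcup_(m in M) U m))
}.

(* Main.v *)
Require Import Defs.
From mathcomp Require Import all_boot all_order all_algebra.
From mathcomp Require Import complex.
From mathcomp Require Import all_classical all_reals all_analysis.
From mathcomp Require finmap.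
From mathcomp Require Import ring lra.
Import Order.TTheory GRing.Theory Num.Theory.
Import numFieldNormedType.Exports.
Set Implicit Arguments.
Unset Strict Implicit.
Unset Printing Implicit Defensive.
Local Open Scope classical_set_scope.
Local Open Scope ring_scope.

(** Write X for C(S). The heart of the matter is [bidual_to_ball]: if (nu_m) is a
    bounded sequence in the dual of X, F lies in the unit ball of the bidual and
    the F(nu_m) are all close to a number c, then some x in the unit ball of X
    itself has nu_m(x) close to c for infinitely many m. The theorem follows
    ([grothendieck_of_approximation]) by applying this to differences of terms of
    two subsequences along which F approaches two of its cluster values.

    For each m, Helly's theorem ([goldstine]) yields y_m in the ball of X with
    nu_i(y_m) close to c for all i <= m; the problem is to replace the sequence
    (y_m) by one function. Two effects have to be separated.

    - The part of the nu_m which is uniformly absolutely continuous with respect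
      to a fixed measure lam. The conditions on y_m define convex sets decreasing
      with m, so nearly minimal norms in L2(lam) and the parallelogram law make
      all y_m close to one of them, x0, in L2(lam) ([sqr_int_close]). For this
      part x0 can be used in place of y_m.

    - The part of the nu_m which concentrates on sets of vanishing lam-measure.
      Along a subsequence these sets can be taken to be disjoint clopen sets U_k,
      almost free of mass for the other nu_m ([concentration]).

    It remains to find a continuous function close to y_(m_k) on U_k and equal to
    x0 away from the U_k. This is where the subsequential completeness property
    enters ([glue]): after rounding to finitely many values it extends the
    prescribed values, along a subsequence, to the closure of the union of the
    U_k. That closure may carry additional mass; choosing the subsequence
    from an uncountable almost disjoint family removes it ([SCP_residual]).

    Measures are represented by functionals: the total variation of nu_m is
    [variation], and the finitely additive measures it induces on clopen sets
    suffice. The real and the complex case are treated together through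
    [scalar_field]. *)

(** * Clopen sets in compact zero-dimensional spaces *)

Section clopen_sets.
Variable S : topologicalType.
Implicit Types A B U : set S.

Lemma clopenD A B : clopen A -> clopen B -> clopen (A `\` B).
Proof. by move=> cA cB; rewrite setDE; apply: clopenI => //; exact: clopenC. Qed.

Lemma clopen_bigsetU n (A : nat -> set S) :
  (forall i, clopen (A i)) -> clopen (\big[setU/set0]_(i < n) A i).
Proof.
move=> cA; elim/big_ind: _ => //; first exact: clopen0.
by move=> *; exact: clopenU.
Qed.

Lemma continuous_if_clopen (T : topologicalType) U (f g : S -> T) :
  clopen U -> continuous f -> continuous g ->
  continuous (fun s => if s \in U then f s else g s).
Proof.
move=> [oU cU] cf cg s.
have [sU|sU] := pselect (U s).
  rewrite /continuous_at mem_set//; apply: cvg_trans (cf s).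
  apply: near_eq_cvg; near=> t; rewrite mem_set//; near: t.
  by apply: open_nbhs_nbhs.
rewrite /continuous_at memNset//; apply: cvg_trans (cg s).
apply: near_eq_cvg; near=> t; rewrite memNset//; near: t.
by apply: open_nbhs_nbhs; split => //; exact: closed_openC.
Unshelve. all: by end_near. Qed.

Lemma continuous_indic (R : realType) U :
  clopen U -> continuous (\1_U : S -> R).
Proof.
move=> cU; have -> : \1_U = (fun s => if s \in U then 1 else 0 : R).
  by apply/funext => s; rewrite indicE; case: (_ \in _).
by apply: continuous_if_clopen => // s; exact: cvg_cst.
Qed.

(** The clopen subsets of B cover A and form a directed family, so by compactness
    one of them contains A. *)
Lemma clopen_between A B : compact [set: S] -> zero_dimensional S ->
  closed A -> open B -> A `<=` B ->
  exists U, [/\ clopen U, A `<=` U & U `<=` B].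
Proof.
move=> cS zS cA oB AB.
have hS : hausdorff_space S.
  rewrite open_hausdorff => x y xy; have [U [[oU cU] Ux Uy]] := zS _ _ xy.
  exists (U, ~` U) => /=; first by rewrite !inE.
  by split => //; [exact: closed_openC|apply/eqP; rewrite setICr].
(* the filter of sections of that directed family *)
pose F := filter_from [set D | clopen D /\ D `<=` B] (fun D => [set E | D `<=` E]).
have FF : Filter F.
  apply: filter_from_filter; first by exists set0; split => //; exact: clopen0.
  move=> D E [cD DB] [cE EB]; exists (D `|` E).
    by split; [exact: clopenU|rewrite subUset].
  by move=> G /=; rewrite subUset.
have cpA : compact A by exact: subclosed_compact cA cS _.
have := (compact_near_coveringP A).1 cpA _ F (fun E x => E x) FF.
case=> [x Ax|D [cD DB] DA]; last by exists D; split => //; exact: DA.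
have /(_ B) := zero_dimensional_cvg hS zS cS (x := x).
case; first by apply: open_nbhs_nbhs; split => //; exact: AB.
move=> D [Dx cD] DB; exists (D, [set E | D `<=` E]) => /=.
  by split; [apply: open_nbhs_nbhs; split => //; case: cD|exists D].
by move=> [y E] /= [Dy]; exact.
Qed.

End clopen_sets.

(** * Positive functionals on continuous functions *)

Lemma ultra_fmap (T U : Type) (f : T -> U) (F : set_system T) :
  UltraFilter F -> UltraFilter (f @ F).
Proof.
move=> UF; have PF : ProperFilter F by exact: ultra_proper.
split; first exact: fmap_proper_filter.
move=> G PG FG; apply/seteqP; split => // A GA.
have [//|nA] := in_ultra_setVsetC (f @^-1` A) UF.
have /FG GnA : (f @ F) (~` A) by exact: nA.
by have /filter_ex[? []] : G (A `&` ~` A) by exact: filterI.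
Qed.

Lemma continuous_bounded_above (R : realType) (S : topologicalType) (f : S -> R) :
  compact [set: S] -> continuous f ->
  exists2 M, 0 < M & forall s, f s <= M.
Proof.
move=> cS cf; have /compact_bounded[M [Mr fM]] : compact (range f).
  by apply: continuous_compact => //; apply: continuous_subspaceT.
exists (`|M| + 1) => [|s]; first by rewrite ltr_wpDl.
apply: le_trans (ler_norm _) _; apply: fM; last by exists s.
by rewrite (le_lt_trans (ler_norm M))// ltrDl.
Qed.

Section positive_functionals.
Variables (R : realType) (S : topologicalType).
Implicit Types (f g : S -> R) (U V : set S) (mu nu : (S -> R) -> R).

Definition nneg_cts f := continuous f /\ forall s, 0 <= f s.

(** The Radon measures of the proof, seen through their values on nonnegative
    continuous functions; on the indicators of clopen sets they are finitely
    additive. *)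
Record positive_functional mu : Prop := PositiveFunctional {
  pfD : forall f g, nneg_cts f -> nneg_cts g ->
    mu (fun s => f s + g s) = mu f + mu g ;
  pf_le : forall f g, nneg_cts f -> nneg_cts g -> (forall s, f s <= g s) ->
    mu f <= mu g ;
  pfZ : forall a f, 0 <= a -> nneg_cts f -> mu (fun s => a * f s) = a * mu f }.

Lemma nneg_cts_indic U : clopen U -> nneg_cts \1_U.
Proof.
by move=> cU; split=> [|s]; [exact: continuous_indic|rewrite indicE].
Qed.

Lemma nneg_cts_cst (a : R) : 0 <= a -> nneg_cts (fun=> a).
Proof. by move=> a0; split => // s; exact: cvg_cst. Qed.

Lemma nneg_ctsD f g : nneg_cts f -> nneg_cts g -> nneg_cts (fun s => f s + g s).
Proof.
move=> [cf f0] [cg g0]; split => s; last exact: addr_ge0.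
by apply: (@cvgD _ _ _ _ _ f g); [exact: cf|exact: cg].
Qed.

Lemma nneg_ctsZ (a : R) f : 0 <= a -> nneg_cts f -> nneg_cts (fun s => a * f s).
Proof.
move=> a0 [cf f0]; split => s; last exact: mulr_ge0.
by apply: (@cvgM _ _ _ _ (fun=> a) f); [exact: cvg_cst|exact: cf].
Qed.

Hint Resolve nneg_cts_indic nneg_ctsD nneg_ctsZ : core.

Section one_functional.
Variables (mu : (S -> R) -> R) (pmu : positive_functional mu).

Lemma pf_ge0 f : nneg_cts f -> 0 <= mu f.
Proof.
move=> nf; have := pfZ pmu (lexx 0) nf; rewrite mul0r => <-.
by apply: (pf_le pmu) => // [|s]; [exact: nneg_ctsZ|rewrite mul0r; apply nf].
Qed.

Lemma pf_set0 : mu \1_set0 = 0.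
Proof.
have := pfZ pmu (lexx 0) (nneg_cts_indic clopen0); rewrite mul0r => <-.
by congr mu; apply/funext => s; rewrite mul0r indic0.
Qed.

Lemma pf_setS U V : clopen U -> clopen V -> U `<=` V -> mu \1_U <= mu \1_V.
Proof.
move=> cU cV UV; apply: (pf_le pmu) => // [||s]; [exact: nneg_cts_indic..|].
rewrite !indicE ler_nat; have [/set_mem/UV sV|_] := boolP (s \in U) => //.
by rewrite mem_set.
Qed.

Lemma pf_setU_disj U V : clopen U -> clopen V -> U `&` V = set0 ->
  mu \1_(U `|` V) = mu \1_U + mu \1_V.
Proof.
move=> cU cV UV; rewrite -(pfD pmu) //; [|exact: nneg_cts_indic..].
congr mu; apply/funext => s; rewrite !indicE in_setU.
have : s \in U -> s \notin V.
  move=> /set_mem sU; apply/negP => /set_mem sV.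
  by rewrite -[False]/(set0 s) -UV.
by case: (s \in U); case: (s \in V) => //=; rewrite ?addr0 ?add0r// => /(_ isT).
Qed.

Lemma pf_setD U V : clopen U -> clopen V ->
  mu \1_(U `|` V) = mu \1_U + mu \1_(V `\` U).
Proof.
move=> cU cV; rewrite -pf_setU_disj//; [|exact: clopenD|by rewrite setDIK].
congr (mu \1__); apply/seteqP; split => s; last first.
  by case=> [|[]]; [left|right].
by have [|nU] := pselect (U s); [left|case=> [//|Vs]; right].
Qed.

Lemma pf_setU U V : clopen U -> clopen V -> mu \1_(U `|` V) <= mu \1_U + mu \1_V.
Proof.
move=> cU cV; rewrite pf_setD// lerD2l; apply: pf_setS => //; exact: clopenD.
Qed.

Lemma pf_sum_disj n (A : nat -> set S) : (forall i, clopen (A i)) ->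
  (forall i j, (i < j < n)%N -> A i `&` A j = set0) ->
  \sum_(i < n) mu \1_(A i) <= mu \1_setT.
Proof.
move=> cA disj; suff -> : \sum_(i < n) mu \1_(A i) =
    mu \1_(\big[setU/set0]_(i < n) A i).
  by rewrite pf_setS//; [exact: clopen_bigsetU|exact: clopenT].
elim: n disj => [|n IH] disj; first by rewrite !big_ord0 pf_set0.
rewrite !big_ord_recr/= IH => [|i j /andP[ij jn]]; last first.
  by rewrite disj// ij ltnW.
rewrite pf_setU_disj//; first exact: clopen_bigsetU.
rewrite setIC big_distrr/= big1// => i _.
by rewrite setIC disj// ltn_ord leqnn.
Qed.

End one_functional.

Lemma positive_functionalD mu nu : positive_functional mu ->
  positive_functional nu -> positive_functional (fun f => mu f + nu f).
Proof.
move=> pm pn; split => [f g nf ng|f g nf ng fg|a f a0 nf].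
- by rewrite (pfD pm)// (pfD pn)// addrACA.
- by rewrite lerD ?(pf_le pm) ?(pf_le pn).
- by rewrite (pfZ pm)// (pfZ pn)// mulrDr.
Qed.

Lemma positive_functional0 : positive_functional (fun=> 0).
Proof.
by split => [f g nf ng|f g nf ng fg|a f a0 nf]; rewrite ?addr0 ?mulr0.
Qed.

Lemma positive_functional_sum n (mu : nat -> (S -> R) -> R) :
  (forall i, positive_functional (mu i)) ->
  positive_functional (fun f => \sum_(i < n) mu i f).
Proof.
move=> pm; elim: n => [|n IH].
  have -> : (fun f => \sum_(i < 0) mu i f) = (fun=> 0).
    by apply/funext => f; rewrite big_ord0.
  exact: positive_functional0.
have -> : (fun f => \sum_(i < n.+1) mu i f) =
    (fun f => \sum_(i < n) mu i f + mu n f).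
  by apply/funext => f; rewrite big_ord_recr.
exact: positive_functionalD.
Qed.

(** Limits along an ultrafilter exist by compactness, and inherit additivity. *)
Lemma positive_functional_ultralim (F : set_system nat)
    (mu : nat -> (S -> R) -> R) (C : R) :
  compact [set: S] -> UltraFilter F ->
  (forall m, positive_functional (mu m)) ->
  (forall m, mu m (fun=> 1) <= C) ->
  exists theta, positive_functional theta /\
    forall f e, nneg_cts f -> theta f < e -> F [set m | mu m f < e].
Proof.
move=> cS UF pmu muC.
have PF : ProperFilter F by exact: ultra_proper.
pose theta f := lim (mu m f @[m --> F]).
have cvgF f : nneg_cts f -> cvg (mu m f @[m --> F]).
  move=> nf; have [cf f0] := nf.
  have [M /ltW M0 fM] := continuous_bounded_above cS cf.
  have muM m : mu m f \in `[0, M * C].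
    rewrite in_itv/= pf_ge0//=.
    apply: le_trans (_ : mu m (fun=> M * 1) <= _).
      apply: (pf_le (pmu m)) => // [|s]; last by rewrite mulr1.
      by apply: nneg_ctsZ => //; exact: nneg_cts_cst.
    by rewrite (pfZ (pmu m))// ?ler_wpM2l//; exact: nneg_cts_cst.
  have := @segment_compact R 0 (M * C); rewrite compact_ultra.
  move=> /(_ _ (ultra_fmap (mu^~ f) UF)); case.
    by apply: (@filterS _ F _ setT _ _ filterT) => m _; exact: muM.
  by move=> l [_ /= ml]; apply/cvg_ex; exists l.
exists theta; split; last first.
  move=> f e nf fe; have /cvgrPdist_lt/(_ (e - theta f)) := cvgF _ nf.
  rewrite subr_gt0 => /(_ fe); apply: filterS => m /=.
  by rewrite ltr_distlC => /andP[_]; rewrite addrC subrK.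
split => [f g nf ng|f g nf ng fg|a f a0 nf].
- rewrite /theta -limD; [|exact: cvgF..]; congr (lim (_ @ F)).
  by apply/funext => m /=; rewrite (pfD (pmu m)).
- apply: ler_lim; [exact: cvgF..|].
  by apply: filterE => m; exact: (pf_le (pmu m)).
- rewrite /theta -[RHS]/(a *: lim _) -limZl_tmp; last exact: cvgF.
  by congr (lim (_ @ F)); apply/funext => m /=; rewrite (pfZ (pmu m)).
Qed.

End positive_functionals.

(** * Almost disjoint families and subsequential completeness *)

Section infinite_sets_of_integers.

Lemma infinite_seq (T : pointedType) (N : set T) : infinite_set N ->
  exists2 e : nat -> T, injective e & forall n, N (e n).
Proof.
move=> iN; have /pcard_leP/injfunPex[e eN ei] := (infiniteP N).1 iN.
exists e => [i j|n]; last exact: eN.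
by apply: ei; rewrite inE.
Qed.

Lemma infinite_imset T (U : Type) (f : T -> U) (M : set T) :
  injective f -> infinite_set M -> infinite_set (f @` M).
Proof.
move=> fI iM fM; apply: iM.
apply: sub_finite_set (@finite_preimage _ _ (f @` M) f _ fM) => [x Mx|].
  by exists x.
by move=> x y _ _; exact: fI.
Qed.

Lemma infinite_unbounded (M : set nat) n : infinite_set M ->
  exists2 m, M m & (n <= m)%N.
Proof.
move=> iM; apply: contrapT => nM; apply: iM.
apply: sub_finite_set (finite_II n) => m Mm /=.
by rewrite ltnNge; apply/negP => nm; apply: nM; exists m.
Qed.

(** A countable union of finite fibers would be countable, against Cantor. *)
Lemma infinite_fiber (I : choiceType) (f : (nat -> bool) -> I) :
  countable [set: I] -> exists i, infinite_set (f @^-1` [set i]).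
Proof.
move=> cI; apply: contrapT => /forallNP fin.
have /countable_injP[g gI] : countable [set: nat -> bool].
  have -> : [set: nat -> bool] = \bigcup_i (f @^-1` [set i]).
    by apply/seteqP; split => // a _; exists (f a).
  by apply: bigcup_countable => // i _; apply: finite_set_countable;
    apply: contrapT; exact: fin.
pose d n := ~~ `[< exists2 a, g a = n & a n >].
have : d (g d) = ~~ d (g d).
  rewrite {1}/d; congr (~~ _); apply/asboolP/idP; last by exists d.
  by case=> a gad; rewrite (gI _ _ _ _ gad)// inE.
by case: (d _).
Qed.

(** The integers coding the nodes of the binary tree along a: distinct branches
    give almost disjoint infinite sets. *)
Definition branch (a : nat -> bool) (n : nat) : nat := pickle (mkseq a n).

Lemma branch_inj a : injective (branch a).
Proof.
move=> m n /(pcan_inj pickleK)/(congr1 size).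
by rewrite !size_mkseq.
Qed.

Lemma branch_almost_disjoint a b : a <> b ->
  exists d, forall m n, branch a m = branch b n -> (m <= d)%N.
Proof.
move=> ab; have /existsNP[d abd] : ~ forall n, a n = b n by move/funext.
exists d => m n /(pcan_inj pickleK) e; rewrite leqNgt; apply/negP => dm.
have := congr1 size e; rewrite !size_mkseq => mn.
by apply: abd; have := congr1 (nth true ^~ d) e; rewrite !nth_mkseq -?mn.
Qed.

End infinite_sets_of_integers.

Definition subsequentially_complete (S : topologicalType) := forall U : nat -> set S,
  (forall n, clopen (U n)) -> trivIset setT U ->
  exists2 M : set nat, infinite_set M & open (closure (\bigcup_(m in M) U m)).

Section subsequential_completeness.
Variables (R : realType) (S : topologicalType).
Hypothesis scp : subsequentially_complete S.
Variable V : nat -> (S -> R) -> R.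
Hypothesis pV : forall j, positive_functional (V j).

Lemma SCP_subset (A : nat -> set S) (e : nat -> nat) :
  (forall n, clopen (A n)) -> trivIset setT A -> injective e ->
  exists M : set nat, [/\ M `<=` range e, infinite_set M &
    open (closure (\bigcup_(m in M) A m))].
Proof.
move=> cA tA eI; have [||M iM oM] := scp (U := A \o e).
- by move=> n; exact: cA.
- apply/trivIsetP => i j _ _ ij /=; move/trivIsetP : tA; apply => //.
  by apply: contra_neq ij; exact: eI.
exists (e @` M); split; first by move=> _ [n _ <-]; exists n.
  exact: infinite_imset.
by rewrite bigcup_image.
Qed.

(** The set W is the closure of the union of the A k, k in M. The mass that a
    measure puts on W but not on the A k is not controlled by the measures of the
    A k. To make it vanish for all V j at once, take W for uncountably many
    almost disjoint M: the parts of the W outside the first p sets A k become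
    pairwise disjoint as p grows, hence at most finitely many of them can
    retain a given amount of mass for a given V j. *)
Lemma SCP_residual (A : nat -> set S) (N : set nat) :
  (forall n, clopen (A n)) -> trivIset setT A -> infinite_set N ->
  exists M W, [/\ [/\ M `<=` N, infinite_set M & clopen W],
    forall k, M k -> A k `<=` W,
    forall O, open O -> (forall k, M k -> O `&` A k = set0) -> O `&` W = set0 &
    forall j eps, 0 < eps ->
      exists p, V j \1_(W `\` \big[setU/set0]_(i < p) A i) < eps].
Proof.
move=> cA tA /infinite_seq[e eI eN].
have /choice[M MP] : forall a : nat -> bool, exists M : set nat,
    [/\ M `<=` range (e \o branch a), infinite_set M &
      open (closure (\bigcup_(m in M) A m))].
  by move=> a; apply: SCP_subset => // i j /eI/branch_inj.
pose W a := closure (\bigcup_(m in M a) A m).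
have cW a : clopen (W a) by split; [case: (MP a)|exact: closed_closure].
have AW a k : M a k -> A k `<=` W a.
  by move=> Mk; apply: subset_trans (@subset_closure _ _); exact: bigcup_sup.
have WO a O : open O -> (forall k, M a k -> O `&` A k = set0) -> O `&` W a = set0.
  move=> oO OA; suff WO : W a `<=` ~` O.
    by apply/seteqP; split => // s [Os /WO].
  rewrite (iffLR (closure_id _) (open_closedC oO)); apply: closure_subset.
  move=> s [k Mk Aks] Os; have := OA _ Mk.
  by move/seteqP => [+ _] => /(_ s); apply.
pose res a p := W a `\` \big[setU/set0]_(i < p) A i.
have cres a p : clopen (res a p).
  by apply: clopenD => //; exact: clopen_bigsetU.
suff [a aP] : exists a, forall j eps, 0 < eps -> exists p, V j \1_(res a p) < eps.
  exists (M a), (W a); split=> [|k|O|//]; [split => //|exact: AW|exact: WO].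
    by move=> k; have [+ _ _] := MP a => /[apply] -[n _ <-]; exact: eN.
  by have [] := MP a.
have disj a b : a <> b ->
    exists q, forall p, (q <= p)%N -> res a p `&` res b p = set0.
  move=> /branch_almost_disjoint[d dP].
  exists (\max_(i < d.+1) e (branch a i)).+1 => p qp.
  have Abig k : (k < p)%N -> A k `<=` \big[setU/set0]_(i < p) A i.
    move=> kp s As; rewrite -bigcup_mkord; exists k => //.
  suff : W a `&` res b p = set0.
    by apply: subsetI_eq0 => //; exact: subDsetl.
  rewrite setIC; apply: (WO a); first by case: (cres b p).
  move=> k Mak; have [kp|pk] := ltnP k p.
    by apply/seteqP; split => // s [[_ +] /(Abig _ kp)].
  suff : A k `&` W b = set0.
    by rewrite setIC; apply: subsetI_eq0 => //; exact: subDsetl.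
  apply: (WO b) => [|l Mbl]; first by case: (cA k).
  move/trivIsetP : tA; apply => //; apply/eqP => kl; move: pk.
  rewrite leqNgt => /negP; apply; apply: leq_trans qp; rewrite ltnS.
  have [/(_ _ Mak)[m _ mk] _ _] := MP a.
  have [/(_ _ Mbl)[n _ nl] _ _] := MP b.
  have md : (m < d.+1)%N by apply: (dP m n); apply: eI; rewrite [LHS]mk [RHS]nl.
  by rewrite -mk; exact: (leq_bigmax (Ordinal md)).
apply: contrapT => /forallNP bad.
have /choice[f fP] : forall a, exists jn : nat * nat,
    forall p, jn.2.+1%:R^-1 <= V jn.1 \1_(res a p).
  move=> a; have /existsNP[j /existsNP[eps /not_implyP[eps0 /forallNP np]]] := bad a.
  exists (j, Num.truncn eps^-1) => p /=; apply: (@le_trans _ _ eps); last first.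
    by rewrite leNgt; apply/negP; exact: np.
  rewrite invf_ple ?posrE ?ltr0n//; apply: ltW; exact: truncnS_gt.
(* more disjoint pieces of mass at least 1 / (n + 1) than the total mass allows *)
have [[j n] /infinite_seq[g gI gP]] := infinite_fiber f (countableP _).
pose m := (Num.truncn (V j \1_setT * n.+1%:R)).+1.
have /choice[q qP] : forall ii : nat * nat, exists q, ii.1 <> ii.2 ->
    forall p, (q <= p)%N -> res (g ii.1) p `&` res (g ii.2) p = set0.
  move=> [i i'] /=; have [->|/eqP ii'] := eqVneq i i'; first by exists 0%N.
  by have [|q qP] := disj (g i) (g i'); [move/gI|exists q].
pose p := \max_(ii : 'I_m * 'I_m) q (val ii.1, val ii.2).
have : \sum_(i < m) V j \1_(res (g i) p) <= V j \1_setT.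
  apply: (pf_sum_disj (pV j) (A := fun i => res (g i) p)) => //.
  move=> i i' /andP[ii' i'm]; apply: (qP (i, i')) => /=.
    by apply/eqP; rewrite ltn_eqF.
  by apply: (leq_bigmax (Ordinal (ltn_trans ii' i'm), Ordinal i'm)).
apply/negP; rewrite -ltNge; apply: (@lt_le_trans _ _ (m%:R * n.+1%:R^-1)).
  by rewrite ltr_pdivlMr ?ltr0n// truncnS_gt.
rewrite -[m in m%:R]card_ord mulr_natl -sumr_const ler_sum// => i _.
by have := fP (g i) p; rewrite (gP i).
Qed.

End subsequential_completeness.

(** * A common description of the real and the complex scalars *)

(** What the proof needs of the scalars K: the real line embeds in K, norms are
    real, K is Euclidean for the inner product [re (cj x * y)], and its closed
    unit disc is compact. *)
Record scalar_field (R : realType) (K : numFieldType) := ScalarField {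
  emb : {rmorphism R -> K} ;
  re : K -> R ;
  cj : K -> K ;
  emb_le : {mono emb : x y / x <= y} ;
  reD : forall x y, re (x + y) = re x + re y ;
  cjD : forall x y, cj (x + y) = cj x + cj y ;
  re_embM : forall r z, re (emb r * z) = r * re z ;
  re1 : re 1 = 1 ;
  emb_re_norm : forall z : K, emb (re `|z|) = `|z| ;
  re_le_norm : forall z : K, re z <= re `|z| ;
  re_cjC : forall x y, re (cj x * y) = re (cj y * x) ;
  re_cjM : forall x : K, re (cj x * x) = re `|x| ^+ 2 ;
  compact_disc : compact ([set z : K | `|z| <= 1] : set K^o) }.

Section scalars.
Variables (R : realType) (K : numFieldType) (sc : scalar_field R K).
Implicit Types (x y z : K) (r : R).
Notation emb := (emb sc).
Notation re := (re sc).
Notation cj := (cj sc).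

Definition abs z : R := re `|z|.

Lemma emb_abs z : emb (abs z) = `|z|.
Proof. exact: emb_re_norm. Qed.

Lemma re_emb r : re (emb r) = r.
Proof. by rewrite -[emb r]mulr1 re_embM re1 mulr1. Qed.

Lemma emb_lt : {mono emb : x y / x < y}.
Proof. exact/leW_mono/(emb_le sc). Qed.

Lemma le_abs x r : (abs x <= r) = (`|x| <= emb r).
Proof. by rewrite -emb_abs (emb_le sc). Qed.

Lemma lt_abs x r : (abs x < r) = (`|x| < emb r).
Proof. by rewrite -emb_abs emb_lt. Qed.

Lemma abs_ge0 x : 0 <= abs x.
Proof. by rewrite -(emb_le sc) emb_abs rmorph0. Qed.

Lemma absD x y : abs (x + y) <= abs x + abs y.
Proof. by rewrite le_abs rmorphD/= !emb_abs ler_normD. Qed.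

Lemma absM x y : abs (x * y) = abs x * abs y.
Proof. by apply: (inc_inj (emb_le sc)); rewrite rmorphM/= !emb_abs normrM. Qed.

Lemma absN x : abs (- x) = abs x.
Proof. by rewrite /abs normrN. Qed.

Lemma absB x y : abs (x - y) = abs (y - x).
Proof. by rewrite /abs distrC. Qed.

Lemma abs0 : abs 0 = 0.
Proof. by apply: (inc_inj (emb_le sc)); rewrite emb_abs normr0 rmorph0. Qed.

Lemma abs_emb r : abs (emb r) = `|r|.
Proof.
wlog r0 : r / 0 <= r => [H|].
  have [|/ltW r0] := leP 0 r; first exact: H.
  by rewrite -[in LHS](opprK r) rmorphN absN H ?normrN// oppr_ge0.
rewrite ger0_norm// /abs ger0_norm ?re_emb//.
by rewrite -(rmorph0 emb) (emb_le sc).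
Qed.

Lemma abs1 : abs 1 = 1.
Proof. by rewrite /abs normr1 re1. Qed.

Lemma abs_eq0 x : (abs x == 0) = (x == 0).
Proof. by rewrite -(inj_eq (inc_inj (emb_le sc))) emb_abs rmorph0 normr_eq0. Qed.

Lemma absV x : abs x^-1 = (abs x)^-1.
Proof. by apply: (inc_inj (emb_le sc)); rewrite fmorphV/= !emb_abs normfV. Qed.

Lemma abs_tri x y z : abs (x - z) <= abs (x - y) + abs (y - z).
Proof. by apply: le_trans (absD _ _); rewrite addrA subrK. Qed.

Lemma re0 : re 0 = 0.
Proof. by apply: (addrI (re 0)); rewrite -reD !addr0. Qed.

Lemma reN x : re (- x) = - re x.
Proof. by apply: (addrI (re x)); rewrite -reD !subrr re0. Qed.

Lemma re_sum I (s : seq I) (F : I -> K) :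
  re (\sum_(i <- s) F i) = \sum_(i <- s) re (F i).
Proof. by elim/big_rec2: _ => [|i y x _ <-]; rewrite ?re0 ?reD. Qed.

Lemma abs_sqrD x y : abs (x + y) ^+ 2 =
  abs x ^+ 2 + re (cj x * y) *+ 2 + abs y ^+ 2.
Proof.
rewrite -!(re_cjM sc) (cjD sc) mulrDl !mulrDr !reD.
by rewrite [re (cj y * x)]re_cjC mulr2n !addrA.
Qed.

Lemma parallelogram x y :
  abs (x + y) ^+ 2 + abs (x - y) ^+ 2 = abs x ^+ 2 *+ 2 + abs y ^+ 2 *+ 2.
Proof. by rewrite !abs_sqrD absN mulrN reN; lra. Qed.

Lemma emb_norm (V : normedModType K) (v : V) : emb (re `|v|) = `|v|.
Proof. by rewrite -[`|v|]normr_id emb_re_norm. Qed.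

Lemma re_norm_ge0 (V : normedModType K) (v : V) : 0 <= re `|v|.
Proof. by rewrite -(emb_le sc) emb_norm rmorph0. Qed.

Lemma continuous_abs (S : topologicalType) (f : S -> K^o) :
  continuous f -> continuous (fun s => abs (f s)).
Proof.
move=> cf s; apply/cvgrPdist_lt => e e0; near=> t.
have ft : `|f s - f t| < emb e.
  near: t; have /cvgrPdist_lt := cf s; apply.
  by rewrite -(rmorph0 emb) emb_lt.
rewrite -lt_abs in ft; apply: le_lt_trans ft; rewrite ler_norml.
have := abs_tri (f s) (f t) 0; have := abs_tri (f t) (f s) 0.
by rewrite !subr0 (absB (f t)); lra.
Unshelve. all: by end_near. Qed.

Lemma continuous_emb (S : topologicalType) (f : S -> R) :
  continuous f -> continuous (fun s => emb (f s) : K^o).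
Proof.
move=> cf s; apply/cvgrPdist_lt => e e0; near=> t.
rewrite -rmorphB -[e]gtr0_norm// -[`|e|]emb_abs -lt_abs abs_emb.
near: t; have /cvgrPdist_lt := cf s; apply.
by rewrite lt_neqAle abs_ge0 eq_sym abs_eq0 gt_eqF.
Unshelve. all: by end_near. Qed.

Lemma finite_net (e : R) : 0 < e -> exists zs : seq K,
  (forall i, abs (nth 0 zs i) <= 1) /\
  forall z, abs z <= 1 -> exists2 i, (i < size zs)%N & abs (z - nth 0 zs i) < e.
Proof.
move=> e0; have := compact_disc sc; rewrite compact_cover => dc.
have [||D DB Dcov] := dc K [set z | `|z| <= 1]
  (fun z => [set w : K^o | `|z - w| < emb e]).
- move=> z _.
  have -> : [set w : K^o | `|z - w| < emb e] = ball (z : K^o) (emb e).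
    by rewrite -ball_normE.
  by apply: ball_open; rewrite -(rmorph0 emb) emb_lt.
- move=> z z1; exists z => //=; by rewrite subrr normr0 -(rmorph0 emb) emb_lt.
exists (finmap.enum_fset D); split => [i|z].
  have [iD|Di] := ltnP i (size (finmap.enum_fset D)); last by rewrite nth_default ?abs0.
  by have := DB _ (mem_nth 0 iD); rewrite inE/= le_abs rmorph1.
rewrite le_abs rmorph1 => /Dcov[w /= wD wz].
exists (index w (finmap.enum_fset D)); first by rewrite index_mem.
by rewrite nth_index// absB lt_abs.
Qed.

End scalars.

(** * Glueing a sequence of functions along disjoint clopen sets *)

Section glueing.
Variables (R : realType) (K : numFieldType) (sc : scalar_field R K).
Variable S : topologicalType.
Hypotheses (cS : compact [set: S]) (zS : zero_dimensional S).
Hypothesis scp : subsequentially_complete S.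
Variable V : nat -> (S -> R) -> R.
Hypothesis pV : forall j, positive_functional (V j).
Notation abs := (abs sc).

Definition unit_ball_fun (x : S -> K^o) := continuous x /\ forall s, abs (x s) <= 1.

Lemma clopen_level (x : S -> K^o) (a b : R) : continuous x -> a < b ->
  exists B, [/\ clopen B, forall s, abs (x s) <= a -> B s &
    forall s, B s -> abs (x s) < b].
Proof.
move=> /(@continuous_abs _ _ sc) cx ab.
have [|||B [cB aB Bb]] := @clopen_between S [set s | abs (x s) <= a]
  [set s | abs (x s) < b] cS zS.
- have -> : [set s | abs (x s) <= a] = (fun s => abs (x s)) @^-1` [set r | r <= a] by [].
  by apply: preimage_closed => //; exact: closed_le.
- have -> : [set s | abs (x s) < b] = (fun s => abs (x s)) @^-1` [set r | r < b] by [].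
  by apply: open_comp => //; exact: open_lt.
- by move=> s /= /le_lt_trans; apply.
- by exists B.
Qed.

(** A function y that follows x k on U k for infinitely many k and equals x0 off
    a clopen set T. Subsequential completeness directly extends, from a
    union of disjoint clopen sets, only the functions constant there. So the
    values of the x k are rounded to a finite net, and the level sets of each
    value (colour) are extended one after the other, along smaller and smaller
    infinite sets of indices. Passing to a subsequence does not harm the colours
    already treated: their clopen sets avoid the level sets of all other
    colours. *)
Lemma glue (U : nat -> set S) (x0 : S -> K^o) (x : nat -> S -> K^o) (eps : R) :
  (forall k, clopen (U k)) -> trivIset setT U -> unit_ball_fun x0 ->
  (forall k, unit_ball_fun (x k)) -> 0 < eps ->
  exists y T M, [/\ [/\ infinite_set M, unit_ball_fun y & clopen T],
    forall s, ~ T s -> y s = x0 s,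
    forall k s, M k -> U k s -> abs (y s - x k s) <= eps &
    forall j e, 0 < e ->
      exists p, V j \1_(T `\` \big[setU/set0]_(i < p) U i) < e].
Proof.
move=> cU tU bx0 bx eps0; pose d := eps / 2.
have d0 : 0 < d by rewrite divr_gt0.
have deps : d < eps by rewrite /d; lra.
have [zs [zs1 net]] := finite_net sc d0.
pose z i := nth 0 zs i.
have /choice[B BP] : forall ki : nat * nat, exists B, [/\ clopen B,
    forall s, abs (x ki.1 s - z ki.2) <= d -> B s &
    forall s, B s -> abs (x ki.1 s - z ki.2) < eps].
  move=> [k i] /=; apply: (@clopen_level (fun s => x k s - z i)) => //.
  by move=> s; apply: cvgB; [case: (bx k) => + _; exact|exact: cvg_cst].
pose A i k := U k `&` (B (k, i) `\` \big[setU/set0]_(j < i) B (k, nat_of_ord j)).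
have cB k i : clopen (B (k, i)) by case: (BP (k, i)).
have cA i k : clopen (A i k).
  apply: clopenI => //; apply: clopenD => //.
  exact: (clopen_bigsetU _ (A := fun j => B (k, j))).
have AU i k : A i k `<=` U k by exact: subIsetl.
have AA i i' k k' : (i, k) <> (i', k') -> A i k `&` A i' k' = set0.
  have [<-|kk' _] := eqVneq k k'; last first.
    apply: subsetI_eq0 (AU _ _) (AU _ _) _.
    by move/trivIsetP : tU; apply.
  wlog ii' : i i' / (i < i')%N => [H|_].
    have [/H//|/H|->//] := ltngtP i i'.
    by rewrite setIC => h ik; apply: h => -[ii]; apply: ik; rewrite ii.
  apply/seteqP; split => // s [[_ [Bi _]] [_ [_ +]]]; apply.
  by rewrite -(bigcup_mkord _ (fun j => B (k, j))); exists i.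
suff [y [T [M [[iM by_ cT] yT yA _ rT]]]] : exists y T M,
    [/\ [/\ infinite_set M, unit_ball_fun y & clopen T],
    forall s, ~ T s -> y s = x0 s,
    forall k i s, M k -> (i < size zs)%N -> A i k s -> y s = z i,
    forall k i, (size zs <= i)%N -> T `&` A i k = set0 &
    forall j e, 0 < e ->
      exists p, V j \1_(T `\` \big[setU/set0]_(i < p) U i) < e].
  exists y, T, M; split => // k s Mk Uks.
  have [i iz xz] := net (x k s) (proj2 (bx k) s).
  have exB : exists i, `[< B (k, i) s >].
    by exists i; apply/asboolP; case: (BP (k, i)) => _ + _; apply; exact: ltW.
  (* the sets A i k, i ranging over the colours, partition U k *)
  case: (ex_minnP exB) => j /asboolP Bj jmin.
  have jz : (j < size zs)%N.
    apply: leq_ltn_trans iz; apply: jmin; apply/asboolP.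
    by case: (BP (k, i)) => _ + _; apply; exact: ltW.
  rewrite (yA k j)//.
    by rewrite absB; apply: ltW; case: (BP (k, j)) => _ _; exact.
  split => //; split => //.
  rewrite -(bigcup_mkord _ (fun j => B (k, j))) => -[l /= lj /asboolP Bl].
  by have := jmin l Bl; rewrite leqNgt lj.
(* y takes the right values on the colours below n, and T avoids the others *)
elim: (size zs) => [|n [y [T [M [[iM [cy y1] cT] yT yA TA rT]]]]].
  exists x0, set0, setT; split => //.
  - by split => //; [exact: infinite_nat|exact: clopen0].
  - by move=> k i _; rewrite set0I.
  - move=> j e e0; exists 0%N; rewrite set0D.
    by rewrite (pf_set0 (pV j)).
have tA : trivIset setT (A n).
  apply/trivIsetP => i j _ _ /eqP ij; apply: AA => -[]; exact: ij.
have [M' [W [[M'M iM' cW] AW WO rW]]] := SCP_residual scp pV (cA n) tA iM.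
have WA i k : i <> n -> W `&` A i k = set0.
  move=> ni; rewrite setIC; apply: WO => [|k' _]; first by case: (cA i k).
  by apply: AA => -[].
exists (fun s => if s \in W then z n else y s), (T `|` W), M'; split.
- split=> //; last exact: clopenU.
  split=> [|s]; last by case: ifP.
  by apply: continuous_if_clopen => // s; exact: cvg_cst.
- move=> s /not_orP[nT nW]; rewrite memNset//; exact: yT.
- move=> k i s M'k; rewrite ltnS leq_eqVlt => /predU1P[->|ltin] As.
    by rewrite mem_set//; exact: AW As.
  rewrite memNset; first by apply: yA As => //; exact: M'M.
  move=> Ws; suff : set0 s by [].
  by rewrite -(WA i k)//; apply/eqP; rewrite ltn_eqF.
- move=> k i ni; rewrite setIUl TA ?(ltnW ni)// set0U WA//.
  by apply/eqP; rewrite gtn_eqF.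
- move=> j e e0; have e2 : 0 < e / 2 by rewrite divr_gt0.
  have [p Tp] := rT j _ e2; have [q Wq] := rW j _ e2.
  pose big (X : nat -> set S) p := \big[setU/set0]_(i < p) X i.
  have bigS (X Y : nat -> set S) p1 q1 : (p1 <= q1)%N -> (forall k, X k `<=` Y k) ->
      big X p1 `<=` big Y q1.
    move=> pq XY; rewrite /big -!bigcup_mkord => s [i /= ip /XY Ys].
    by exists i => //=; exact: leq_trans pq.
  have cbig (X : nat -> set S) q1 : (forall k, clopen (X k)) -> clopen (big X q1).
    by move=> cX; exact: clopen_bigsetU.
  exists (maxn p q).
  have cTp : clopen (T `\` big U p) by apply: clopenD => //; exact: cbig.
  have cWq : clopen (W `\` big (A n) q) by apply: clopenD => //; exact: cbig.
  apply: le_lt_trans (_ : V j \1_((T `\` big U p) `|` (W `\` big (A n) q)) < _).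
    apply: (pf_setS (pV j)); [|exact: clopenU|].
      by apply: clopenD; [exact: clopenU|exact: cbig].
    rewrite setDUl; apply: setUSS; apply: setDS.
      by apply: (bigS U U); [exact: leq_maxl|move=> k].
    by apply: (bigS (A n) U); [exact: leq_maxr|exact: AU].
  apply: le_lt_trans (pf_setU (pV j) cTp cWq) _.
  by rewrite (splitr e) ltrD.
Qed.

End glueing.

(** * The total variation of a functional *)

Section variation.
Variables (R : realType) (K : numFieldType) (sc : scalar_field R K).
Variable cK : order_complete K.
Variables (S : topologicalType) (cS : compact [set: S]).
Notation X := (cspace cK cS).
Notation abs := (abs sc).
Notation emb := (emb sc).
Implicit Types (nu : dual cK X) (g : X) (f : S -> R).

Lemma abs_unit (w : K) : exists2 u, abs u = 1 & u * w = emb (abs w).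
Proof.
have [->|w0] := eqVneq w 0; first by exists 1; rewrite ?abs1// mulr0 abs0 rmorph0.
exists (emb (abs w) / w); last by rewrite divfK.
by rewrite absM absV abs_emb ger0_norm ?abs_ge0// divff// abs_eq0.
Qed.

Lemma unit_ball_funP g : `|g| <= 1 <-> unit_ball_fun sc g.
Proof.
split=> [g1|[_ g1]].
  split=> [|s]; first exact: cts_fun.
  by rewrite le_abs rmorph1; apply: le_trans (sup_norm_ge g s) g1.
by apply: sup_norm_le => // s; rewrite -(rmorph1 emb) -le_abs.
Qed.

Lemma abs_functional_le nu g : `|g| <= 1 -> abs (nu g) <= re sc `|nu|.
Proof.
by move=> g1; rewrite -(emb_le sc) emb_abs (emb_norm sc nu); exact: dual_norm_ge.
Qed.

Definition dominated f g := forall s, abs (g s) <= f s.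

(** The value at f of the total variation measure of the functional nu. *)
Definition variation nu f : R := sup [set abs (nu g) | g in dominated f].

Lemma variation_has_sup nu f : nneg_cts f ->
  has_sup [set abs (nu g) | g in dominated f].
Proof.
move=> [cf f0]; split.
  by exists (abs (nu 0)), 0 => // s; rewrite abs0.
have [M M0 fM] := continuous_bounded_above cS cf.
exists (M * re sc `|nu|) => _ [g gf <-].
have : abs (nu (emb M^-1 *: g)) <= re sc `|nu|.
  apply/abs_functional_le/unit_ball_funP; split; first exact: cts_fun.
  move=> s; rewrite -[(_ *: g) s]/(emb M^-1 * g s) absM abs_emb.
  rewrite gtr0_norm ?invr_gt0// mulrC ler_pdivrMr// mul1r.
  exact: le_trans (gf s) (fM s).
rewrite linearZ/= absM abs_emb gtr0_norm ?invr_gt0// mulrC.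
by rewrite ler_pdivrMr// mulrC.
Qed.

Lemma variation_ge nu f g : nneg_cts f -> dominated f g ->
  abs (nu g) <= variation nu f.
Proof.
move=> nf gf; apply: sup_upper_bound; first exact: variation_has_sup.
by exists g.
Qed.

Lemma variation_le nu f c :
  (forall g, dominated f g -> abs (nu g) <= c) -> nneg_cts f ->
  variation nu f <= c.
Proof.
move=> fc nf; apply: ge_sup; first by case: (variation_has_sup nu nf).
by move=> _ [g gf <-]; exact: fc.
Qed.

Lemma variation1 nu : variation nu (fun=> 1) <= re sc `|nu|.
Proof.
apply: variation_le; last exact: nneg_cts_cst.
by move=> g g1; apply/abs_functional_le/unit_ball_funP; split => //; exact: cts_fun.
Qed.

(** Functions dominated by f1 and by f2 can be rotated so that their images under
    nu are nonnegative and add up. *)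
Lemma variation_superadditive nu f1 f2 : nneg_cts f1 -> nneg_cts f2 ->
  variation nu f1 + variation nu f2 <= variation nu (fun s => f1 s + f2 s).
Proof.
move=> n1 n2; rewrite -lerBrDr; apply: variation_le => // g1 gf1.
rewrite lerBrDr -lerBrDl; apply: variation_le => // g2 gf2.
rewrite lerBrDl.
have [u1 u11 uw1] := abs_unit (nu g1); have [u2 u21 uw2] := abs_unit (nu g2).
have -> : abs (nu g1) + abs (nu g2) = abs (nu (u1 *: g1 + u2 *: g2)).
  rewrite linearD !linearZ/= -[u1 *: _]/(u1 * nu g1) -[u2 *: _]/(u2 * nu g2).
  by rewrite uw1 uw2 -rmorphD abs_emb ger0_norm// addr_ge0// abs_ge0.
apply: variation_ge; first exact: nneg_ctsD.
move=> s; rewrite -[(_ + _ : X) s]/(u1 * g1 s + u2 * g2 s).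
by apply: le_trans (absD _ _ _) _; rewrite !absM u11 u21 !mul1r lerD.
Qed.

(** A function dominated by f1 + f2 is split in proportion to f1 and f2; a small
    constant eta keeps the denominator positive and takes a negligible third
    share. *)
Lemma variation_subadditive nu f1 f2 : nneg_cts f1 -> nneg_cts f2 ->
  variation nu (fun s => f1 s + f2 s) <= variation nu f1 + variation nu f2.
Proof.
move=> n1 n2; have [c1 p1] := n1; have [c2 p2] := n2.
have C0 : 0 < re sc `|nu| + 1.
  by rewrite ltr_wpDl// -(emb_le sc) emb_norm rmorph0.
apply/ler_addgt0Pr => e e0.
pose eta := e / (re sc `|nu| + 1).
have eta0 : 0 < eta by rewrite divr_gt0.
apply: variation_le; last exact: nneg_ctsD.
move=> g gf.
pose den s := f1 s + f2 s + eta.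
have den0 s : 0 < den s by rewrite ltr_wpDl// addr_ge0.
have cden : continuous den.
  move=> s; apply: cvgD; last exact: cvg_cst.
  by apply: cvgD; [exact: c1|exact: c2].
have cpart (h : S -> R) : continuous h ->
    continuous (fun s => emb (h s / den s) * g s : K^o).
  have cg : continuous (g : S -> K^o) by exact: cts_fun.
  move=> ch s; apply: (@cvgM K _ _ _ (fun s => emb (h s / den s)) g); last exact: cg.
  apply: (@continuous_emb _ _ sc S (fun s => h s / den s)) => t.
  by apply: cvgM; [exact: ch|apply: cvgV; [rewrite gt_eqF|exact: cden]].
pose part (h : S -> R) (ch : continuous h) : X := mkcts (cpart h ch).
have ceta : continuous (fun _ : S => eta) by move=> s; exact: cvg_cst.
have gE : g = part _ c1 + part _ c2 + part _ ceta.
  apply/val_inj/funext => s /=.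
  rewrite -[LHS]/(g s) -[RHS]/(emb (f1 s / den s) * g s +
    emb (f2 s / den s) * g s + emb (eta / den s) * g s).
  by rewrite -!mulrDl -!rmorphD -!mulrDl divff ?gt_eqF ?(den0 s)// rmorph1 mul1r.
have part_le (h : S -> R) (ch : continuous h) (s : S) :
    0 <= h s -> abs (part _ ch s) <= h s.
  move=> h0; rewrite -[part _ ch s]/(emb (h s / den s) * g s) absM abs_emb.
  rewrite ger0_norm; last by rewrite divr_ge0// ltW.
  rewrite mulrAC ler_pdivrMr// ler_wpM2l//.
  by apply: le_trans (gf s) _; rewrite lerDl ltW.
rewrite {}gE !linearD/=; apply: le_trans (absD _ _ _) _; apply: lerD.
  apply: le_trans (absD _ _ _) _; apply: lerD.
    by apply: variation_ge => // s; exact: part_le.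
  by apply: variation_ge => // s; exact: part_le.
have : abs (nu (emb eta^-1 *: part _ ceta)) <= re sc `|nu|.
  apply/abs_functional_le/unit_ball_funP; split; first exact: cts_fun.
  move=> s; rewrite -[(_ *: part _ ceta) s]/(emb eta^-1 * part _ ceta s) absM abs_emb.
  rewrite gtr0_norm ?invr_gt0// mulrC ler_pdivrMr// mul1r.
  exact: part_le (ltW _).
rewrite linearZ/= absM abs_emb gtr0_norm ?invr_gt0// ler_pdivrMl//.
move=> /le_trans; apply; rewrite /eta mulrAC ler_pdivrMr// ler_wpM2l ?lerDl//.
exact: ltW.
Qed.

Lemma variation_homogeneous nu a f : 0 <= a -> nneg_cts f ->
  variation nu (fun s => a * f s) = a * variation nu f.
Proof.
rewrite le_eqVlt => /predU1P[<-|a0] nf.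
  have n0 : nneg_cts (fun s => 0 * f s) by exact: nneg_ctsZ.
  apply/eqP; rewrite mul0r eq_le; apply/andP; split.
    apply: variation_le => // g g0; suff -> : g = 0 by rewrite linear0 abs0.
    apply/val_inj/funext => s; apply/eqP; rewrite -(abs_eq0 sc).
    by rewrite eq_le abs_ge0 andbT; have := g0 s; rewrite mul0r.
  apply: le_trans (variation_ge nu (g := 0) n0 _); first exact: abs_ge0.
  by move=> s; rewrite mul0r abs0.
have le b h : 0 < b -> nneg_cts h ->
    variation nu (fun s => b * h s) <= b * variation nu h.
  move=> b0 nh; apply: variation_le; last by apply: nneg_ctsZ => //; exact: ltW.
  move=> g gbh; rewrite -ler_pdivrMl//.
  have -> : b^-1 * abs (nu g) = abs (nu (emb b^-1 *: g)).
    by rewrite linearZ/= absM abs_emb gtr0_norm ?invr_gt0.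
  apply: variation_ge => // s; rewrite -[(_ *: g) s]/(emb b^-1 * g s).
  by rewrite absM abs_emb gtr0_norm ?invr_gt0// ler_pdivrMl.
apply/eqP; rewrite eq_le le//= -ler_pdivlMl//.
have := le a^-1 (fun s => a * f s); rewrite invr_gt0.
have -> : (fun s => a^-1 * (a * f s)) = f.
  by apply/funext => s; rewrite mulKf ?gt_eqF.
by apply => //; apply: nneg_ctsZ => //; exact: ltW.
Qed.

Lemma variation_positive nu : positive_functional (variation nu).
Proof.
split=> [f g nf ng|f g nf ng fg|a f]; last exact: variation_homogeneous.
  by apply/eqP; rewrite eq_le variation_subadditive ?variation_superadditive.
by apply: variation_le => // h hf; apply: variation_ge => // s; exact: le_trans (fg s).
Qed.

End variation.

(** * Approximating an element of the bidual on finitely many functionals *)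

(** A stand-in for suprema: near optimality up to a fixed step is all that the
    extremal arguments below require. *)
Lemma archimedean_step (R : realType) (P : R -> Prop) (step M : R) :
  0 < step -> P 0 -> (forall r, M <= r -> ~ P r) ->
  exists s, [/\ 0 <= s, P s & ~ P (s + step)].
Proof.
move=> step0 P0 PM; apply: contrapT => H.
have Pn n : P (n%:R * step).
  elim: n => [|n IH]; first by rewrite mul0r.
  apply: contrapT => nP; apply: H; exists (n%:R * step); split => //.
    by rewrite mulr_ge0// ltW.
  by rewrite -[X in _ + X]mul1r -mulrDl natr1.
apply: (PM _ _ (Pn (Num.truncn (M / step)).+1)).
by rewrite -ler_pdivrMr// ltW// truncnS_gt.
Qed.

Section goldstine.
Variables (R : realType) (K : numFieldType) (sc : scalar_field R K).
Variables (cK : order_complete K) (X : normedModType K).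
Notation abs := (abs sc).
Notation emb := (emb sc).
Notation re := (re sc).

Lemma dual_abs_le (V : normedModType K) (F : dual cK V) (v : V) :
  abs (F v) <= re `|F| * re `|v|.
Proof.
have [->|v0] := eqVneq v 0.
  by rewrite linear0 abs0 mulr_ge0// re_norm_ge0.
rewrite -(emb_le sc) rmorphM/= emb_abs (emb_norm sc F) (emb_norm sc v).
have : `|F (`|v|^-1 *: v)| <= `|F| by apply: dual_norm_ge; rewrite normfZV.
by rewrite linearZ/= normrM normfV normr_id mulrC ler_pdivrMr ?normr_gt0.
Qed.

(** Helly's theorem, the finite form of Goldstine's. Suppose (F (nu k))_k has
    distance at least e from the convex set of all (nu k y)_k, y in the ball, and
    let x be nearly nearest. The difference of the two vectors gives a
    combination phi of the nu k with re (phi y) larger than re (F phi) for all y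
    in the ball; as the ball is balanced, the norm of phi is then smaller than
    the modulus of F phi. *)
Lemma goldstine (nu : nat -> dual cK X) (F : dual cK (dual cK X)) n (e : R) :
  `|F| <= 1 -> 0 < e ->
  exists2 x : X, `|x| <= 1 & forall k, (k < n)%N -> abs (nu k x - F (nu k)) < e.
Proof.
move=> F1 e0; apply: contrapT => far.
pose p k := F (nu k).
pose d (x : X) := \sum_(k < n) abs (nu k x - p k) ^+ 2.
have d_ge x : `|x| <= 1 -> e ^+ 2 <= d x.
  move=> x1; rewrite leNgt; apply/negP => dx; apply: far; exists x => // k kn.
  rewrite -(@ltr_pXn2r _ 2)// ?nnegrE ?abs_ge0 ?ltW//; apply: le_lt_trans dx.
  rewrite /d (bigD1 (Ordinal kn))//= lerDl sumr_ge0// => i _.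
  by rewrite sqr_ge0.
pose A := \sum_(k < n) (re `|nu k| *+ 2) ^+ 2.
have A0 : 0 <= A by rewrite sumr_ge0// => i _; rewrite sqr_ge0.
have d00 : 0 <= d 0 by rewrite sumr_ge0// => i _; rewrite sqr_ge0.
(* the length of the segment from x towards y along which d is differentiated *)
pose t := e ^+ 2 / (A + e ^+ 2 + 1).
have e20 : 0 < e ^+ 2 by rewrite exprn_gt0.
have den0 : 0 < A + e ^+ 2 + 1 by lra.
have t0 : 0 < t by rewrite divr_gt0.
have t1 : t <= 1 by rewrite ler_pdivrMr//; lra.
have tA : t * A <= e ^+ 2 by rewrite mulrAC ler_pdivrMr// ler_wpM2l//; lra.
have [|||s [s0 sd /existsNP[x /not_implyP[x1 /negP]]]] :=
  @archimedean_step R (fun s => forall x : X, `|x| <= 1 -> s <= d x)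
    (t * e ^+ 2 / 2) (d 0 + 1).
- by rewrite divr_gt0// mulr_gt0.
- by move=> x _; rewrite sumr_ge0// => i _; rewrite sqr_ge0.
- move=> r dr /(_ 0); rewrite normr0 => /(_ ler01) rd.
  by have := le_trans dr rd; lra.
rewrite -ltNge => dx.
pose q k := nu k x - p k.
pose phi : dual cK X := \sum_(k < n) cj sc (q k) *: nu k.
have phiE y : phi y = \sum_(k < n) cj sc (q k) * nu k y.
  by rewrite /phi; elim/big_rec2: _ => // k z g _ <-.
have FphiE : F phi = \sum_(k < n) cj sc (q k) * p k.
  by rewrite /phi linear_sum; apply: eq_bigr => k _; rewrite linearZ.
have re_phix : re (phi x) = d x + re (F phi).
  rewrite phiE FphiE !re_sum -big_split/=; apply: eq_bigr => k _.
  by rewrite -(re_cjM sc) -reD -mulrDr subrK.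
have phi_large y : `|y| <= 1 -> re (F phi) + e ^+ 2 / 4 <= re (phi y).
  move=> y1; pose w k := nu k (y - x).
  have wA : \sum_(k < n) abs (w k) ^+ 2 <= A.
    apply: ler_sum => k _; rewrite ler_pXn2r ?nnegrE ?abs_ge0//; last first.
      by rewrite mulrn_wge0// re_norm_ge0.
    rewrite /w linearB/=; apply: le_trans (absD _ _ _) _; rewrite absN mulr2n.
    by apply: lerD; (apply: le_trans (dual_abs_le _ _) _;
      rewrite ler_piMr ?re_norm_ge0// -(emb_le sc) emb_norm rmorph1).
  have phiw : \sum_(k < n) re (cj sc (q k) * w k) = re (phi y) - re (phi x).
    rewrite -reN -reD !phiE -sumrB re_sum; apply: eq_bigr => k _.
    by rewrite /w linearB/= mulrBr.
  have := sd (x + emb t *: (y - x)).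
  have -> : d (x + emb t *: (y - x)) = d x +
      t * ((re (phi y) - re (phi x)) *+ 2) + t ^+ 2 * \sum_(k < n) abs (w k) ^+ 2.
    rewrite -phiw -sumrMnl !mulr_sumr -!big_split/=; apply: eq_bigr => k _.
    rewrite linearD linearZ/= -[emb t *: _]/(emb t * w k).
    have -> : nu k x + emb t * w k - p k = q k + emb t * w k by rewrite addrAC.
    rewrite (abs_sqrD sc (q k) (emb t * w k)) absM abs_emb gtr0_norm// exprMn.
    by rewrite mulrCA re_embM mulrnAr.
  have -> : `|x + emb t *: (y - x)| <= 1.
    rewrite scalerBr addrCA -[x in x - _]scale1r -scalerBl addrC.
    apply: le_trans (ler_normD _ _) _; rewrite !normrZ.
    have -> : `|1 - emb t| = emb (1 - t).
      rewrite -(rmorph1 emb) -rmorphB ger0_norm//.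
      by rewrite -(rmorph0 emb) (emb_le sc) subr_ge0.
    have -> : `|emb t| = emb t.
      by rewrite ger0_norm// -(rmorph0 emb) (emb_le sc) ltW.
    apply: (@le_trans _ _ (emb (1 - t) + emb t)); last first.
      by rewrite -rmorphD subrK rmorph1.
    apply: lerD; rewrite ler_piMr// -(rmorph0 emb) (emb_le sc) ?subr_ge0//.
    exact: ltW.
  move=> /(_ isT) sle.
  have tS : t ^+ 2 * \sum_(k < n) abs (w k) ^+ 2 <= t * e ^+ 2.
    rewrite expr2 -mulrA; apply: (ler_wpM2l (ltW t0)); apply: le_trans tA.
    exact: (ler_wpM2l (ltW t0)).
  have : 0 <= t * ((re (phi y) - re (phi x)) *+ 2 + e ^+ 2 * (3 / 2)).
    by rewrite mulrDr; lra.
  rewrite pmulr_rge0// re_phix; have := d_ge _ x1; lra.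
(* the ball is balanced, so the lower bound on re phi bounds its norm *)
have norm_phi : `|phi| <= emb (- (re (F phi) + e ^+ 2 / 4)).
  apply: dual_norm_le => y y1; rewrite -(le_abs sc).
  have [u u1 uw] := abs_unit sc (phi y).
  have := phi_large ((- u) *: y); rewrite normrZ normrN.
  have -> : `|u| = 1 by rewrite -(emb_abs sc) u1 rmorph1.
  rewrite mul1r => /(_ y1); rewrite linearZ/= -[(- u) *: _]/(- u * phi y).
  by rewrite mulNr uw reN re_emb; lra.
have := dual_abs_le F phi.
have : re `|F| * re `|phi| <= re `|phi|.
  by rewrite ler_piMl ?re_norm_ge0// -(emb_le sc) (emb_norm sc F) rmorph1.
have : re `|phi| <= - (re (F phi) + e ^+ 2 / 4).
  by rewrite -(emb_le sc) (emb_norm sc phi).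
have := re_le_norm sc (- F phi); rewrite normrN reN.
by rewrite /abs; lra.
Qed.

End goldstine.

(** * Splitting off the concentrated parts of a bounded sequence *)

Section concentration.
Variables (R : realType) (S : topologicalType).
Hypothesis cS : compact [set: S].
Variables (V : nat -> (S -> R) -> R) (C : R).
Hypothesis pV : forall m, positive_functional (V m).
Hypothesis VC : forall m, V m (fun=> 1) <= C.

Lemma inv_lt_eventually (r : R) a : 0 < r ->
  exists2 j, (a <= j)%N & j.+1%:R^-1 < r.
Proof.
move=> r0; exists (maxn a (Num.truncn r^-1)); first exact: leq_maxl.
rewrite invf_plt ?posrE ?ltr0n//; apply: lt_le_trans (truncnS_gt _) _.
by rewrite ler_nat ltnS leq_maxr.
Qed.

(** A quantitative subsequence splitting lemma: along a subsequence, the V m have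
    disjoint sets U k off which they are small on all sets of small
    lam-measure, and V (m k) barely charges the other U i.

    Along a fixed free ultrafilter the V m converge to theta; lam is theta plus
    finitely many of the V m. Let t be, up to eps, the largest mass that V m
    retains, for almost all m, on sets that are arbitrarily small for theta and
    for every V i. If V m carries mass t on a small set U, then another small
    set D cannot carry more than eps outside U. Such sets are chosen
    inductively. That theta is small on the union of the sets already chosen
    ensures that almost all V m are small there, which makes the sets disjoint at
    a small cost; that the new set is small for the functionals already chosen
    takes care of these. *)
Lemma concentration (eps : R) : 0 < eps ->
  exists (lam : (S -> R) -> R) (delta : R) (m : nat -> nat) (U : nat -> set S),
  [/\ [/\ positive_functional lam, 0 < delta & injective m],
      (forall k, clopen (U k)) /\ trivIset setT U,
      forall k p, V (m k) \1_(\big[setU/set0]_(i < p) U i `\` U k) <= 2 * eps &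
      forall k D, clopen D -> lam \1_D < delta ->
        V (m k) \1_(D `\` U k) <= 2 * eps].
Proof.
move=> eps0.
have [F [UF Foo]] := ultraFilterLemma (eventually_filter : ProperFilter \oo).
have PF : ProperFilter F by exact: ultra_proper.
have [theta [ptheta thetaF]] := positive_functional_ultralim cS UF pV VC.
pose lam j f := theta f + \sum_(i < j.+1) V i f.
have plam j : positive_functional (lam j).
  by apply: positive_functionalD => //; exact: positive_functional_sum.
have lam_theta j U : clopen U -> theta \1_U <= lam j \1_U.
  move=> cU; rewrite lerDl sumr_ge0// => i _; apply: (pf_ge0 (pV i)).
  exact: nneg_cts_indic.
have lam_V j i U : clopen U -> (i <= j)%N -> V i \1_U <= lam j \1_U.
  move=> cU ij; rewrite /lam (bigD1 (Ordinal (ij : (i < j.+1)%N)))//= addrCA lerDl.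
  rewrite addr_ge0 ?(pf_ge0 ptheta)//; first exact: nneg_cts_indic.
  rewrite sumr_ge0// => l _; apply: (pf_ge0 (pV l)); exact: nneg_cts_indic.
have lam_mono i j U : clopen U -> (i <= j)%N -> lam i \1_U <= lam j \1_U.
  move=> cU ij; rewrite lerD2l -(subnKC ij) -addSn big_split_ord/= lerDl.
  by rewrite sumr_ge0// => l _; apply: (pf_ge0 (pV _)); exact: nneg_cts_indic.
pose good t := forall j, F [set m | exists U,
  [/\ clopen U, lam j \1_U < j.+1%:R^-1 & t <= V m \1_U]].
have [||t [t0 tgood]] := @archimedean_step R good eps (C + 1) eps0.
- move=> j; apply: filterE => m; exists set0; split; first exact: clopen0.
    by rewrite (pf_set0 (plam j)) invr_gt0 ltr0n.
  by rewrite (pf_set0 (pV m)).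
- move=> r Cr /(_ 0%N) /filter_ex[m [U [cU _ rU]]].
  have : V m \1_U <= V m (fun=> 1).
    apply: (pf_le (pV m)); [exact: nneg_cts_indic|exact: nneg_cts_cst|].
    by move=> s; rewrite indicE; case: (_ \in _).
  by have := VC m; lra.
move=> /existsNP[j0 nj0].
have {nj0}Fj0 : F [set m | forall U, clopen U -> lam j0 \1_U < j0.+1%:R^-1 ->
    V m \1_U < t + eps].
  have [//|] := in_ultra_setVsetC [set m | exists U,
    [/\ clopen U, lam j0 \1_U < j0.+1%:R^-1 & t + eps <= V m \1_U]] UF.
  apply: filterS => m nm U cU lU; rewrite ltNge; apply/negP => tV.
  by apply: nm; exists U.
pose delta : R := j0.+1%:R^-1 / 2.
have delta0 : 0 < delta by rewrite divr_gt0// invr_gt0 ltr0n.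
have next (kmW : nat * (nat * set S)) : exists mW' : nat * set S,
    let: (k, (m, W)) := kmW in let: (m', W') := mW' in
    clopen W -> theta \1_W < eps ->
    [/\ [/\ clopen W', theta \1_W' < eps, W `<=` W' & (m < m')%N],
        V m' \1_W < eps, lam m \1_(W' `\` W) < eps / 2 ^+ k.+1 &
        forall D, clopen D -> lam j0 \1_D < delta ->
          V m' \1_(D `\` (W' `\` W)) <= 2 * eps].
  case: kmW => k [m W].
  have [[cW tW]|nW] := pselect (clopen W /\ theta \1_W < eps); last first.
    by exists (0%N, set0) => cW tW; case: nW.
  have r0 : 0 < Num.min delta (Num.min (eps / 2 ^+ k.+1) (eps - theta \1_W)).
    by rewrite !lt_min delta0 subr_gt0 tW divr_gt0// exprn_gt0.
  have [j mj] := inv_lt_eventually (maxn m j0) r0.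
  rewrite !lt_min => /and3P[jdelta jk jW].
  have Fm : F [set m' | (m < m')%N] by apply: Foo; exists m.+1.
  have [m' /= [[[U [cU lU tU]] m'W] [Gm' mm']]] := filter_ex (filterI (filterI
    (tgood j) (thetaF _ _ (nneg_cts_indic _ cW) tW)) (filterI Fj0 Fm)).
  have [mlej j0j] : (m <= j)%N /\ (j0 <= j)%N by apply/andP; rewrite -geq_max.
  have cWU : clopen (W `|` U) by exact: clopenU.
  have cd : clopen ((W `|` U) `\` W) by exact: clopenD.
  exists (m', W `|` U) => _ _; split => //.
  - split => //.
    apply: le_lt_trans (pf_setU ptheta cW cU) _.
    rewrite addrC -ltrBrDr; exact: le_lt_trans (lam_theta j _ cU) (lt_trans lU jW).
  - apply: le_lt_trans (lt_trans lU jk).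
    apply: le_trans (lam_mono m j _ cU mlej); apply: (pf_setS (plam m)) => //.
    by move=> s [[]].
  move=> D cD lD.
  apply: le_trans (_ : V m' \1_(W `|` (D `\` U)) <= _).
    apply: (pf_setS (pV m')).
    + exact: clopenD.
    + by apply: clopenU => //; exact: clopenD.
    + move=> s [Ds nWU]; have [|nWs] := pselect (W s); first by left.
      by right; split => // Us; apply: nWU; split => //; right.
  apply: le_trans (pf_setU (pV m') cW (clopenD cD cU)) _.
  have : V m' \1_(U `|` D) < t + eps.
    apply: Gm'; first exact: clopenU.
    apply: le_lt_trans (pf_setU (plam j0) cU cD) _.
    rewrite [ltRHS]splitr ltrD//.
    exact: le_lt_trans (lam_mono _ _ _ cU j0j) (lt_trans lU jdelta).
  by rewrite (pf_setD (pV m') cU cD); lra.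
have {next} [nx nxP] := choice next.
(* W k is the union of the sets chosen before stage k *)
pose st := fix st k := if k is k'.+1 then nx (k', st k') else (0%N, set0).
pose W k := (st k).2; pose mm k := (st k).1.
have inv k : clopen (W k) /\ theta \1_(W k) < eps.
  elim: k => [|k [cW tW]].
    by split; [exact: clopen0|rewrite /W/= (pf_set0 ptheta)].
  have := nxP (k, st k); rewrite /W/=; move: cW tW; rewrite /W.
  by case: (st k) => m W1; case: (nx _) => m' W2 cW tW /(_ cW tW)[[]].
have stP k : [/\ W k `<=` W k.+1, (mm k < mm k.+1)%N, V (mm k.+1) \1_(W k) < eps,
    lam (mm k) \1_(W k.+1 `\` W k) < eps / 2 ^+ k.+1 &
    forall D, clopen D -> lam j0 \1_D < delta ->
          V (mm k.+1) \1_(D `\` (W k.+1 `\` W k)) <= 2 * eps].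
  have := nxP (k, st k); have := inv k; rewrite /mm /W/=.
  by case: (st k) => m W1; case: (nx _) => m' W2 [cW tW] /(_ cW tW)[[]].
have cW k : clopen (W k) by case: (inv k).
have W_mono i j : (i <= j)%N -> W i `<=` W j.
  move: i j; apply: (@homo_leq _ W (fun A B => A `<=` B)) => [A //|B A D|k].
    exact: subset_trans.
  by case: (stP k).
have mm_mono : {mono mm : i j / (i <= j)%N}.
  apply: leq_mono; apply: (@homo_ltn _ mm (fun i j => (i < j)%N)) => [y x z|k].
    exact: ltn_trans.
  by case: (stP k).
pose U k := W k.+1 `\` W k.
have cU k : clopen (U k) by exact: clopenD.
have UW p : \big[setU/set0]_(i < p) U i = W p.
  elim: p => [|p IH]; first by rewrite big_ord0.
  rewrite big_ord_recr/= IH; apply/seteqP; split=> s.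
    by case=> [|[]//]; apply: W_mono.
  by have [|nW] := pselect (W p s); [left|right].
(* the tail of a geometric series, summed up to p *)
have tail k p : (k < p)%N ->
    V (mm k.+1) \1_(W p `\` W k.+1) <= eps * (1 - (2 ^+ p)^-1).
  elim: p => // p IH; rewrite ltnS leq_eqVlt => /predU1P[<-|kp].
    rewrite setDv (pf_set0 (pV _)) mulr_ge0 ?(ltW eps0)// subr_ge0.
    by rewrite invf_le1 ?exprn_gt0// exprn_ege1// ler1n.
  apply: le_trans (_ : V (mm k.+1) \1_((W p `\` W k.+1) `|` U p) <= _).
    apply: (pf_setS (pV _)); [exact: clopenD|by apply: clopenU => //; exact: clopenD|].
    move=> s [Ws nWs]; have [|nW] := pselect (W p s); first by left.
    by right.
  apply: le_trans (pf_setU (pV _) (clopenD (cW _) (cW _)) (cU p)) _.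
  have VU : V (mm k.+1) \1_(U p) <= eps / 2 ^+ p.+1.
    have [_ _ _ lU _] := stP p; apply: ltW; apply: le_lt_trans lU.
    by apply: lam_V => //; rewrite mm_mono.
  apply: le_trans (lerD (IH kp) VU) _.
  by rewrite -mulrDr ler_wpM2l ?(ltW eps0)// exprS invfM; lra.
exists (lam j0), delta, (fun k => mm k.+1), U; split.
- by split => // i j /eqP; rewrite eqn_leq !mm_mono -eqn_leq => /eqP[].
- split => //; apply/trivIsetP => i j _ _.
  wlog ij : i j / (i < j)%N => [H ij|_].
    have /orP[ij'|ij'] : (i < j)%N || (j < i)%N by rewrite -neq_ltn.
      exact: H.
    by rewrite setIC; apply: H => //; rewrite eq_sym.
  by apply/seteqP; split => // s [[Wi _] [_]]; apply; exact: W_mono Wi.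
- move=> k p; rewrite UW; pose q := maxn p k.+1.
  apply: le_trans (_ : V (mm k.+1) \1_(W k `|` (W q `\` W k.+1)) <= _).
    apply: (pf_setS (pV _)); first exact: clopenD.
      by apply: clopenU => //; exact: clopenD.
    move=> s [Wp nU]; have [|nW] := pselect (W k s); first by left.
    right; split; first by apply: W_mono Wp; exact: leq_maxl.
    by move=> Wk; apply: nU.
  apply: le_trans (pf_setU (pV _) (cW k) (clopenD (cW _) (cW _))) _.
  have [_ _ Vk _ _] := stP k.
  have := tail k q (leq_maxr _ _).
  have : eps * (1 - (2 ^+ q)^-1) <= eps.
    by rewrite ler_piMr ?(ltW eps0)// gerDl oppr_le0 invr_ge0 exprn_ge0.
  by lra.
- by move=> k; case: (stP k).
Qed.
End concentration.

(** * Approximating an element of the bidual on infinitely many functionals *)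

Section approximation.
Variables (R : realType) (K : numFieldType) (sc : scalar_field R K).
Variable cK : order_complete K.
Variables (S : topologicalType) (cS : compact [set: S]).
Notation X := (cspace cK cS).
Notation abs := (abs sc).
Notation emb := (emb sc).
Notation re := (re sc).

Section L2.
Variables (lam : (S -> R) -> R) (plam : positive_functional lam).

Definition sqr_int (x : X) := lam (fun s => abs (x s) ^+ 2).

Lemma nneg_cts_sqr (x : X) : nneg_cts (fun s => abs (x s) ^+ 2).
Proof.
split=> s; last by rewrite sqr_ge0.
have cx : continuous (fun s => abs (x s)).
  by apply: continuous_abs => t; exact: cts_fun.
by apply: (@cvgM _ _ _ _ (fun s => abs (x s))); exact: cx.
Qed.

Lemma sqr_int_parallelogram (x y : X) :
  sqr_int (x - y) + 4 * sqr_int (emb 2^-1 *: (x + y)) =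
  2 * sqr_int x + 2 * sqr_int y.
Proof.
have nZ b (g : X) : 0 <= b -> nneg_cts (fun s => b * abs (g s) ^+ 2).
  by move=> b0; apply: nneg_ctsZ => //; exact: nneg_cts_sqr.
rewrite /sqr_int -!(pfZ plam)//; try exact: nneg_cts_sqr.
rewrite -!(pfD plam); try exact: nZ; try exact: nneg_cts_sqr.
congr lam; apply/funext => s.
rewrite -[(x - y) s]/(x s - y s) -[(_ *: (x + y)) s]/(emb 2^-1 * (x s + y s)).
rewrite absM abs_emb ger0_norm ?invr_ge0// exprMn.
by have := parallelogram sc (x s) (y s); lra.
Qed.

(** In a decreasing sequence of midpoint convex sets, nearly minimal elements for
    a Hilbertian seminorm are close to each other, by the parallelogram law. *)
Lemma sqr_int_close (A : nat -> set X) (tau : R) : 0 < tau ->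
  (forall m x y, A m x -> A m y -> A m (emb 2^-1 *: (x + y))) ->
  (forall m n, (m <= n)%N -> A n `<=` A m) ->
  (forall m, A m !=set0) ->
  (forall x, A 0%N x -> `|x| <= 1) ->
  exists2 x0, A 0%N x0 &
    forall m, exists2 x, A m x & sqr_int (x - x0) <= 4 * tau.
Proof.
move=> tau0 Amid Adec A0 Aball.
have [||s [_ [j sj] ns]] := @archimedean_step R
    (fun s => exists j, forall x, A j x -> s <= sqr_int x) tau (lam (fun=> 1) + 1) tau0.
- exists 0%N => x _; exact: (pf_ge0 plam (nneg_cts_sqr x)).
- move=> r r1 [j rj]; have [x Ax] := A0 j.
  suff : sqr_int x <= lam (fun=> 1) by have := rj _ Ax; lra.
  apply: (pf_le plam); [exact: nneg_cts_sqr|exact: nneg_cts_cst|move=> t].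
  have [_ x1] := (unit_ball_funP sc x).1 (Aball _ (Adec _ _ (leq0n j) _ Ax)).
  by rewrite expr_le1 ?abs_ge0.
have small m : exists2 x, A m x & sqr_int x < s + tau.
  apply: contrapT => nm; apply: ns; exists m => x Ax.
  by rewrite leNgt; apply/negP => ?; apply: nm; exists x.
have [x0 Ax0 x0s] := small j.
exists x0; first exact: Adec Ax0.
move=> m; have [x Ax xs] := small (maxn m j).
exists x; first by apply: Adec Ax; exact: leq_maxl.
have := sj _ (Amid j x x0 (Adec _ _ (leq_maxr m j) _ Ax) Ax0).
by have := sqr_int_parallelogram x x0; lra.
Qed.

End L2.

Hypothesis zS : zero_dimensional S.
Hypothesis scp : subsequentially_complete S.

(** Let x m in the ball approximate F on nu 0, ..., nu m. By convexity the x m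
    may be taken close to a fixed x0 in L2 of lam, where lam, the m k and the U k
    come from concentration. So x0 and x (m k) differ appreciably only on U k and
    on a set of small lam-measure, which nu (m k) barely charges off U k. The
    function that equals x (m k) on U k and x0 elsewhere would do; glueing
    provides a continuous substitute for infinitely many k. *)
Lemma bidual_to_ball (nu : nat -> dual cK X) (F : dual cK (dual cK X))
    (C e : R) (c : K) :
  (forall m, re `|nu m| <= C) -> `|F| <= 1 -> 0 < e ->
  (forall m, abs (F (nu m) - c) <= e) ->
  exists2 x : X, `|x| <= 1 & infinite_set [set m | abs (nu m x - c) <= (C + 12) * e].
Proof.
move=> nuC F1 e0 Fc; pose V m := variation sc (nu m).
have pV m : positive_functional (V m) by exact: variation_positive.
have VC m : V m (fun=> 1) <= C by apply: le_trans (variation1 sc (nu m)) _.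
have [lam [delta [m [U [[plam delta0 mI] [cU tU] VU Vlam]]]]] :=
  concentration cS pV VC e0.
pose A n := [set x : X | `|x| <= 1 /\
  forall k, (k < n)%N -> abs (nu k x - c) <= 2 * e].
have emb_half : `|emb 2^-1| = emb 2^-1.
  by rewrite ger0_norm// -(rmorph0 emb) (emb_le sc) invr_ge0.
pose tau := e ^+ 2 * delta / 64.
have tau0 : 0 < tau by rewrite divr_gt0// mulr_gt0// exprn_gt0.
have [||||x0 [x01 _] x0close] := @sqr_int_close lam plam A tau tau0.
- move=> n x y [x1 xn] [y1 yn]; split.
    rewrite normrZ emb_half; apply: le_trans (ler_wpM2l _ (ler_normD x y)) _.
      by rewrite -(rmorph0 emb) (emb_le sc) invr_ge0.
    apply: le_trans (ler_wpM2l _ (lerD x1 y1)) _.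
      by rewrite -(rmorph0 emb) (emb_le sc) invr_ge0.
    by rewrite -(rmorph1 emb) -rmorphD -rmorphM (emb_le sc); lra.
  move=> k kn; rewrite linearZ linearD/= -[_ *: _]/(emb 2^-1 * (nu k x + nu k y)).
  have -> : emb 2^-1 * (nu k x + nu k y) - c =
      emb 2^-1 * ((nu k x - c) + (nu k y - c)).
    rewrite addrACA -opprD [RHS]mulrBr; congr (_ - _).
    rewrite -mulr2n -[c *+ 2]mulr_natl mulrA -(rmorph_nat emb 2) -rmorphM.
    by rewrite mulVf ?rmorph1 ?mul1r.
  rewrite absM abs_emb ger0_norm ?invr_ge0//.
  rewrite ler_pdivrMl//; apply: le_trans (absD _ _ _) _.
  by have := xn k kn; have := yn k kn; lra.
- by move=> i j ij x [x1 xj]; split => // k ki; apply: xj; exact: leq_trans ij.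
- move=> n; have [x x1 xF] := goldstine sc nu n F1 e0.
  exists x; split => // k kn; apply: le_trans (abs_tri _ _ (F (nu k)) _) _.
  by have := xF k kn; have := Fc k; lra.
- by move=> x [].
have /choice[xx xxP] : forall k, exists x : X, A (m k).+1 x /\
    sqr_int lam (x - x0) <= 4 * tau.
  by move=> k; have [x] := x0close (m k).+1; exists x.
have bxx k : unit_ball_fun sc (xx k) by apply/unit_ball_funP; case: (xxP k) => -[].
have bx0 : unit_ball_fun sc x0 by apply/unit_ball_funP.
have [y [T [M [[iM by_ cT] yT yM rT]]]] :=
  glue cS zS scp pV cU tU bx0 bxx e0.
pose Y : X := mkcts (by_.1 : continuous y).
have Y1 : `|Y| <= 1 by apply/(unit_ball_funP sc).
exists Y => //; apply: sub_infinite_set (infinite_imset mI iM).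
move=> _ [k Mk <-] /=.
have [[_ /(_ _ (ltnSn _)) xxc] xx_close] := xxP k.
have cd : continuous (fun s => xx k s - x0 s : K^o).
  by move=> s; apply: cvgB; exact: cts_fun.
have e2e : e / 2 < e by lra.
have [B [cB Ble Blt]] := clopen_level sc cS zS cd e2e.
(* off B the two functions differ by more than e / 2, on B by less than e *)
have lamB : lam \1_(~` B) < delta.
  have cBC : clopen (~` B) by exact: clopenC.
  have : lam (fun s => (e / 2) ^+ 2 * \1_(~` B) s) <= sqr_int lam (xx k - x0).
    apply: (pf_le plam); [|exact: nneg_cts_sqr|move=> s].
      by apply: nneg_ctsZ; [exact: sqr_ge0|exact: nneg_cts_indic].
    rewrite indicE; have [/set_mem nB|_] := boolP (s \in ~` B); last first.
      by rewrite mulr0 sqr_ge0.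
    rewrite mulr1 -[(xx k - x0) s]/(xx k s - x0 s).
    rewrite ler_pXn2r ?nnegrE ?abs_ge0 ?divr_ge0 ?(ltW e0)//.
    by rewrite leNgt; apply/negP => /ltW/Ble.
  rewrite (pfZ plam) ?sqr_ge0//; last exact: nneg_cts_indic.
  move=> /le_trans /(_ xx_close).
  have -> : 4 * tau = (e / 2) ^+ 2 * (delta / 4) by rewrite /tau exprMn; lra.
  rewrite ler_pM2l ?exprn_gt0 ?divr_gt0// => /le_lt_trans; apply.
  by rewrite ltr_pdivrMr// ltr_pMr// ltr1n.
have cTU : clopen (T `\` U k) by exact: clopenD.
have cBU : clopen (~` B `\` U k) by apply: clopenD => //; exact: clopenC.
have VT : V (m k) \1_(T `\` U k) <= 3 * e.
  have [p Tp] := rT (m k) e e0.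
  pose Up := \big[setU/set0]_(i < p) U i.
  have cUp : clopen Up by exact: clopen_bigsetU.
  apply: le_trans (_ : V (m k) \1_((T `\` Up) `|` (Up `\` U k)) <= _).
    apply: (pf_setS (pV _)) => //; first by apply: clopenU; exact: clopenD.
    move=> s [Ts nUs]; have [Us|nU] := pselect (Up s); [by right|by left].
  apply: le_trans (pf_setU (pV _) (clopenD cT cUp) (clopenD cUp (cU k))) _.
  by have := VU k p; rewrite -/Up; move: Tp; rewrite -/Up; lra.
have VB : V (m k) \1_(~` B `\` U k) <= 2 * e.
  by apply: Vlam => //; exact: clopenC.
(* y and xx k are e-close on U k and, off U k, outside T and inside B *)
pose bound s := e * 1 + (2 * \1_(T `\` U k) s + 2 * \1_(~` B `\` U k) s).
have nb1 : nneg_cts (fun _ : S => e * 1) by apply: nneg_cts_cst; rewrite mulr1 ltW.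
have nbT := nneg_ctsZ (ler0n R 2) (nneg_cts_indic R cTU).
have nbB := nneg_ctsZ (ler0n R 2) (nneg_cts_indic R cBU).
have nuYx : abs (nu (m k) (Y - xx k)) <= V (m k) bound.
  apply: variation_ge; first by apply: nneg_ctsD => //; exact: nneg_ctsD.
  move=> s; rewrite -[(Y - xx k) s]/(y s - xx k s) /bound !indicE mulr1.
  have le2 : abs (y s - xx k s) <= 2.
    apply: le_trans (absD _ _ _) _; rewrite absN.
    have := by_.2 s; have := (bxx k).2 s; lra.
  have : ~ U k s -> T s -> (s \in T `\` U k)%:R = 1 :> R by move=> *; rewrite mem_set.
  have : ~ U k s -> ~ B s -> (s \in ~` B `\` U k)%:R = 1 :> R.
    by move=> *; rewrite mem_set.
  move: (ler0n R (s \in T `\` U k)) (ler0n R (s \in ~` B `\` U k)).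
  move: (_%:R : R) (_%:R : R) => u v u0 v0 vE uE.
  have [Us|nU] := pselect (U k s); first by have := yM k s Mk Us; lra.
  have [Ts|nT] := pselect (T s); first by have := uE nU Ts; lra.
  have [Bs|nB] := pselect (B s); last by have := vE nU nB; lra.
  by rewrite (yT s nT) absB; have := Blt s Bs; lra.
have Vbound : V (m k) bound = e * V (m k) (fun=> 1) +
    (2 * V (m k) \1_(T `\` U k) + 2 * V (m k) \1_(~` B `\` U k)).
  rewrite (pfD (pV _) nb1 (nneg_ctsD nbT nbB)) (pfD (pV _) nbT nbB).
  rewrite !(pfZ (pV _)) ?ltW//; try exact: nneg_cts_indic.
  exact: nneg_cts_cst.
(* 12 = 2 + 2 * 3 + 2 * 2, from xxc, VT and VB *)
have -> : nu (m k) Y - c = nu (m k) (Y - xx k) + (nu (m k) (xx k) - c).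
  by rewrite linearB/= addrA subrK.
apply: le_trans (absD _ _ _) _.
have : e * V (m k) (fun=> 1) <= e * C by rewrite ler_wpM2l ?(ltW e0).
by rewrite mulrDl [C * e]mulrC; lra.
Qed.

End approximation.

(** * Cluster points *)

Section grothendieck_property.
Variables (R : realType) (K : numFieldType) (sc : scalar_field R K).
Variables (cK : order_complete K) (X : normedModType K).
Notation abs := (abs sc).
Notation emb := (emb sc).
Notation re := (re sc).

Lemma supremum_le (A : set K) M : 0 <= M -> ubound A M -> supremum 0 A <= M.
Proof.
move=> M0 AM; have [->|A0] := eqVneq A set0; first by rewrite /supremum eqxx.
have [_] := supremumsP cK (proj1 (set0P _) A0) (ex_intro _ M AM); exact.
Qed.

Lemma supremum_ge (A : set K) M a : ubound A M -> A a -> a <= supremum 0 A.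
Proof.
move=> AM Aa; have [+ _] := supremumsP cK (ex_intro _ a Aa) (ex_intro _ M AM).
exact.
Qed.

Lemma clust_near (a : nat -> K) p (e : R) N : clust a p -> 0 < e ->
  exists2 n, (N <= n)%N & abs (a n - p) < e.
Proof.
move=> ap e0; have [||_ [[n Nn <-] pn]] := ap (a @` [set n | (N <= n)%N])
  (ball (p : K^o) (emb e)).
- by exists N => // n /= Nn; exists n.
- by apply: nbhsx_ballx; rewrite -(rmorph0 emb) emb_lt.
by exists n => //; rewrite absB lt_abs; move: pn; rewrite -ball_normE.
Qed.

Lemma clust_abs_le (a : nat -> K) p (C : R) :
  (forall n, abs (a n) <= C) -> clust a p -> abs p <= C.
Proof.
move=> aC ap; apply/ler_addgt0Pr => e e0.
have [n _ an] := clust_near 0 ap e0.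
have := abs_tri sc p (a n) 0; rewrite !subr0 absB.
by have := aC n; lra.
Qed.

Lemma compact_disc_radius (C : R) : 0 <= C ->
  compact ([set z : K | abs z <= C] : set K^o).
Proof.
move=> C0; have -> : [set z : K | abs z <= C] =
    (fun z : K^o => emb C * z : K^o) @` [set z : K | `|z| <= 1].
  apply/seteqP; split => z /=; last first.
    move=> [w w1 <-]; rewrite absM abs_emb ger0_norm// ler_piMr// le_abs.
    by rewrite rmorph1.
  have [->|Cn0] := eqVneq C 0.
    move=> z0; exists 0; first by rewrite normr0.
    rewrite mulr0; apply/esym/eqP; rewrite -(abs_eq0 sc).
    by rewrite eq_le z0 abs_ge0.
  have Cp : 0 < C by rewrite lt_neqAle eq_sym Cn0.
  move=> zC; exists (emb C^-1 * z).
    rewrite -(rmorph1 emb) -(le_abs sc) absM abs_emb gtr0_norm ?invr_gt0//.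
    by rewrite ler_pdivrMl// mulr1.
  by rewrite mulrA -rmorphM divff// rmorph1 mul1r.
apply: continuous_compact; last exact: (compact_disc sc).
by apply: continuous_subspaceT; exact: mulrl_continuous.
Qed.

(** Both subsequences converge along an ultrafilter that contains the set I. *)
Lemma clust_pair (a b : nat -> K) (na nb : nat -> nat) (I : set nat) (c : K)
    (C r : R) :
  0 <= C -> (forall n, abs (a n) <= C) -> (forall n, abs (b n) <= C) ->
  (forall k, (k <= na k)%N) -> (forall k, (k <= nb k)%N) ->
  infinite_set I -> (forall k, I k -> abs (a (na k) - b (nb k) - c) <= r) ->
  exists p q, [/\ clust a p, clust b q & abs (p - q - c) <= r].
Proof.
move=> C0 aC bC kna knb iI Ir.
have [F [UF IF]] : exists F, UltraFilter F /\ within I \oo `<=` F.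
  apply: ultraFilterLemma; apply: Build_ProperFilter_ex => A [N _ NA].
  have [n In Nn] := infinite_unbounded N iI.
  by exists n; apply: NA.
have PF : ProperFilter F by exact: ultra_proper.
have FI : F I by apply: IF; exists 0%N.
have Fge N : F [set k | (N <= k)%N] by apply: IF; exists N => // k Nk _.
have lim (u : nat -> K) (nu : nat -> nat) : (forall n, abs (u n) <= C) ->
    (forall k, (k <= nu k)%N) ->
    exists2 p, clust u p & u (nu k) @[k --> F] --> (p : K^o).
  move=> uC knu; have := compact_disc_radius C0; rewrite compact_ultra.
  move=> /(_ _ (ultra_fmap (fun k => u (nu k)) UF))[|p [_ up]].
    by apply: (@filterS _ F _ setT _ _ filterT) => k _; exact: uC.
  exists p => // A B [N _ NA] pB.
  have FB : F [set k | B (u (nu k))] by exact: up.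
  have [k /= [Bk Nk]] := filter_ex (filterI FB (Fge N)).
  by exists (u (nu k)); split => //; apply: NA => /=; exact: leq_trans (knu k).
have [p ap Fp] := lim _ _ aC kna; have [q bq Fq] := lim _ _ bC knb.
exists p, q; split => //; apply/ler_addgt0Pr => e e0.
have e20 : 0 < emb (e / 2) by rewrite -(rmorph0 emb) emb_lt divr_gt0.
have /cvgrPdist_lt/(_ _ e20) Fpe := Fp; have /cvgrPdist_lt/(_ _ e20) Fqe := Fq.
have [k [[/= pk qk] Ik]] := filter_ex (filterI (filterI Fpe Fqe) FI).
rewrite -lt_abs in pk; rewrite -lt_abs in qk.
have -> : p - q - c = (p - a (na k)) + ((a (na k) - b (nb k) - c) + (b (nb k) - q)).
  by ring.
have := absD sc (p - a (na k))
  ((a (na k) - b (nb k) - c) + (b (nb k) - q)).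
have := absD sc (a (na k) - b (nb k) - c) (b (nb k) - q).
by rewrite (absB sc (b _)); have := Ir k Ik; lra.
Qed.

Lemma diam_le (A : set K) (C : R) : 0 <= C -> (forall p, A p -> abs p <= C) ->
  ubound [set `|x.1 - x.2| | x in A `*` A] (emb (2 * C)).
Proof.
move=> C0 AC _ [[p q] [/= Ap Aq] <-]; rewrite -le_abs.
by have := absD sc p (- q); rewrite absN; have := AC _ Ap; have := AC _ Aq; lra.
Qed.

(** Two cluster points p1, p2 of (F (xs n)) are approached along two subsequences
    na and nb; the hypothesis, applied to the differences xs (na k) - xs (nb k),
    provides a point x at which xs has cluster points almost as far apart. *)
Lemma grothendieck_of_approximation :
  (forall (nu : nat -> dual cK X) (F : dual cK (dual cK X)) (C e : R) (c : K),
    (forall m, re `|nu m| <= C) -> `|F| <= 1 -> 0 < e ->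
    (forall m, abs (F (nu m) - c) <= e) ->
    exists2 x : X, `|x| <= 1 &
      infinite_set [set m | abs (nu m x - c) <= (C + 12) * e]) ->
  grothendieck cK X 1.
Proof.
move=> approx; split => // xs xs_bnd; rewrite mul1r.
have [C [C0 xsC]] : exists C, 0 <= C /\ forall n, re `|xs n| <= C.
  have [M [Mr MP]] := xs_bnd; exists (abs (M + 1)); split; first exact: abs_ge0.
  move=> n; rewrite -(emb_le sc) emb_norm emb_abs.
  have /(_ n I) /le_trans := MP (M + 1) (ltr_pwDr ltr01 (lexx M)); apply.
  by rewrite real_ler_norm// realD// real1.
have ptC (V : normedModType K) (G : dual cK V) (v : V) (D : R) :
    re `|v| <= D -> `|G| <= 1 -> abs (G v) <= D.
  move=> vD G1; apply: le_trans (dual_abs_le sc G v) _.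
  apply: le_trans vD; rewrite ler_piMl ?re_norm_ge0//.
  by rewrite -(emb_le sc) emb_norm rmorph1.
have xsxC x n : `|x| <= 1 -> abs (xs n x) <= C.
  move=> x1; apply: le_trans (dual_abs_le sc _ _) _.
  apply: le_trans (xsC n); rewrite ler_piMr ?re_norm_ge0//.
  by rewrite -(emb_le sc) emb_norm rmorph1.
have diam_ub x : `|x| <= 1 -> diam (clust (fun n => xs n x)) <= emb (2 * C).
  move=> x1; apply: supremum_le; last first.
    by apply: diam_le => // p; apply: clust_abs_le => n; exact: xsxC.
  by rewrite -(rmorph0 emb) (emb_le sc) mulr_ge0.
have wstar_ge x : `|x| <= 1 -> diam (clust (fun n => xs n x)) <= delta_wstar xs.
  move=> x1; apply: (supremum_ge (M := emb (2 * C))); last by exists x.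
  by move=> _ [z z1 <-]; exact: diam_ub.
have diam_ge x p q : `|x| <= 1 -> clust (fun n => xs n x) p ->
    clust (fun n => xs n x) q -> `|p - q| <= diam (clust (fun n => xs n x)).
  move=> x1 xp xq; apply: (supremum_ge (M := emb (2 * C))); last by exists (p, q).
  by apply: diam_le => // r; apply: clust_abs_le => n; exact: xsxC.
have w0 : 0 <= delta_wstar xs.
  have x01 : `|0 : X| <= 1 by rewrite normr0.
  have [p xp] : clust (fun n => xs n 0) !=set0.
    exists 0 => A B [N _ NA] B0; exists 0; split; last exact: nbhs_singleton.
    by have := NA N (leqnn N); rewrite /= linear0.
  apply: le_trans (wstar_ge 0 x01); apply: le_trans (diam_ge 0 p p x01 xp xp).
  exact: normr_ge0.
apply: supremum_le => // _ [F F1 <-].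
apply: supremum_le => // _ [[p1 p2] /= [Fp1 Fp2] <-].
have -> : delta_wstar xs = emb (abs (delta_wstar xs)) by rewrite emb_abs ger0_norm.
rewrite -le_abs; apply/ler_addgt0Pr => e e0.
pose eta := e / (2 * C + 12).
have eta0 : 0 < eta by rewrite divr_gt0//; lra.
have eta20 : 0 < eta / 2 by rewrite divr_gt0.
have /choice[na naP] : forall k, exists n, (k <= n)%N /\ abs (F (xs n) - p1) < eta / 2.
  by move=> k; have [n kn nn] := clust_near k Fp1 eta20; exists n.
have /choice[nb nbP] : forall k, exists n, (k <= n)%N /\ abs (F (xs n) - p2) < eta / 2.
  by move=> k; have [n kn nn] := clust_near k Fp2 eta20; exists n.
have [||||x x1 xI] := approx (fun k => xs (na k) - xs (nb k)) F (2 * C) eta (p1 - p2).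
- move=> k; rewrite -(emb_le sc) emb_norm; apply: le_trans (ler_normB _ _) _.
  rewrite -(emb_norm sc (xs (na k))) -(emb_norm sc (xs (nb k))) -rmorphD (emb_le sc).
  by have := xsC (na k); have := xsC (nb k); lra.
- exact: F1.
- exact: eta0.
- move=> k; rewrite linearB/=.
  have -> : F (xs (na k)) - F (xs (nb k)) - (p1 - p2) =
      (F (xs (na k)) - p1) - (F (xs (nb k)) - p2).
    by ring.
  apply: le_trans (absD _ _ _) _; rewrite absN.
  by have := (naP k).2; have := (nbP k).2; lra.
have [p [q [xp xq]]] := clust_pair C0 (fun n => xsxC x n x1) (fun n => xsxC x n x1)
  (fun k => (naP k).1) (fun k => (nbP k).1) xI (fun k kI => kI).
have -> : (2 * C + 12) * eta = e.
  by rewrite /eta mulrC divfK// gt_eqF//; lra.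
move=> pqe.
have : abs (p - q) <= abs (delta_wstar xs).
  rewrite -(emb_le sc) !emb_abs [leRHS]ger0_norm//.
  by apply: le_trans (wstar_ge x x1); exact: diam_ge.
have := abs_tri sc (p1 - p2) (p - q) 0; rewrite !subr0 (absB sc (p1 - p2)).
by move: pqe; lra.
Qed.

End grothendieck_property.

(** * The two scalar fields *)

Section real_scalars.
Variable R : realType.

Lemma compact_real_disc : compact ([set z : R | `|z| <= 1] : set R^o).
Proof.
have -> : [set z : R | `|z| <= 1] = `[-1, 1]%classic.
  by apply/seteqP; split => z /=; rewrite in_itv/= ler_norml.
exact: segment_compact.
Qed.

Definition real_scalars : scalar_field R R.
Proof.
apply: (@ScalarField R R (idfun : {rmorphism R -> R}) id id) => //=.
- by move=> z; exact: ler_norm.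
- by move=> x y; rewrite mulrC.
- by move=> x; rewrite -expr2 real_normK// num_real.
- exact: compact_real_disc.
Defined.

End real_scalars.

Section complex_scalars.
Variable R : realType.
Local Open Scope complex_scope.

Lemma complex_norm_le1 (z : R[i]) :
  (`|z| <= 1) = (complex.Re z ^+ 2 + complex.Im z ^+ 2 <= 1).
Proof.
rewrite normc_def -[1 in LHS]/(1%:C) lecR.
by rewrite -[1 in LHS]sqrtr1 ler_psqrt// ?nnegrE ?addr_ge0 ?sqr_ge0.
Qed.

(** An ultrafilter on the disc converges as its real and imaginary parts do. *)
Lemma compact_complex_disc : compact ([set z : R[i] | `|z| <= 1] : set R[i]^o).
Proof.
rewrite compact_ultra => F UF Fdisc; have PF : ProperFilter F by exact: ultra_proper.
have part (f : R[i] -> R) : (forall z, `|z| <= 1 -> `|f z| <= 1) ->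
    exists l : R, f z @[z --> F] --> l.
  move=> f1; have := @compact_real_disc R; rewrite compact_ultra.
  move=> /(_ _ (ultra_fmap f UF))[|l [_ fl]]; last by exists l.
  by apply: (@filterS _ F _ _ _ _ Fdisc) => z z1; exact: (f1 z z1).
have part1 (a b : R) : a ^+ 2 + b ^+ 2 <= 1 -> `|a| <= 1.
  move=> ab; rewrite -(@expr_le1 _ 2)// real_normK ?num_real//.
  by apply: le_trans ab; rewrite lerDl sqr_ge0.
have [|a Fa] := part (@complex.Re R).
  by move=> z; rewrite complex_norm_le1 => /part1.
have [|b Fb] := part (@complex.Im R).
  by move=> z; rewrite complex_norm_le1 addrC => /part1.
exists (a +i* b); split => /=.
  rewrite complex_norm_le1/=.
  have Fab : complex.Re z * complex.Re z + complex.Im z * complex.Im z @[z --> F] -->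
      a * a + b * b by apply: cvgD; apply: cvgM.
  rewrite !expr2 -(cvg_lim _ Fab)//; apply: limr_le.
    by apply/cvg_ex; exists (a * a + b * b).
  by apply: filterS Fdisc => z /=; rewrite complex_norm_le1 !expr2.
suff : id z @[z --> F] --> (a +i* b : R[i]^o) by [].
apply/cvgrPdist_lt => e e0.
have [e1 E] : 0 < complex.Re e /\ e = (complex.Re e)%:C.
  move: e0; rewrite ltcE/= => /andP[/eqP i0 ->]; split => //.
  by case: e i0 => x y /= ->.
have e2 : 0 < complex.Re e / 2 by rewrite divr_gt0.
have /cvgrPdist_lt/(_ _ e2) Fae := Fa; have /cvgrPdist_lt/(_ _ e2) Fbe := Fb.
apply: filterS (filterI Fae Fbe) => -[x y] /= [ax by_].
rewrite E; apply: le_lt_trans (_ : (`|a - x| + `|b - y|)%:C < _); last first.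
  by rewrite ltcR; lra.
rewrite normc_def/= lecR -[leRHS]ger0_norm ?addr_ge0// -[leRHS]sqrtr_sqr.
rewrite ler_psqrt ?nnegrE ?addr_ge0 ?sqr_ge0// [leRHS]sqrrD !real_normK ?num_real//.
by rewrite addrAC lerDl mulrn_wge0// mulr_ge0.
Qed.

Definition complex_scalars : scalar_field R R[i].
Proof.
apply: (@ScalarField R R[i] (real_complex R : {rmorphism R -> R[i]})
  (@complex.Re R) (@conjc R)).
- by move=> x y; rewrite lecR.
- by move=> [a b] [c d].
- by move=> [a b] [c d]; rewrite rmorphD.
- by move=> r [a b]; rewrite /= mul0r subr0.
- by [].
- by move=> z; rewrite normc_def.
- move=> z; apply: le_trans (ler_norm _) _.
  by have := normc_ge_Re z; rewrite normc_def lecR.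
- by move=> [a b] [c d] /=; lra.
- move=> [a b]; rewrite normc_def/= sqr_sqrtr ?addr_ge0 ?sqr_ge0//; lra.
- exact: compact_complex_disc.
Defined.

End complex_scalars.

Lemma haydon_grothendieck (R : realType) (K : numFieldType)
    (sc : scalar_field R K) (cK : order_complete K) (S : topologicalType)
    (hS : haydon_space S) :
  grothendieck cK (cspace cK (haydon_compact hS)) 1.
Proof.
apply: (grothendieck_of_approximation (sc := sc)) => nu F C e c.
exact: bidual_to_ball (haydon_separated hS) (haydon_SCP hS) _ _ _ _ _.
Qed.

Theorem theorem1p3 (R : realType) (S : topologicalType)
    (hS : haydon_space S) :
  grothendieck (@real_order_complete R)
    (cspace (@real_order_complete R) (haydon_compact hS)) 1 /\
  grothendieck (@complex_order_complete R)
    (cspace (@complex_order_complete R) (haydon_compact hS)) 1.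
Proof.
split; first exact: (haydon_grothendieck (real_scalars R)).
exact: (haydon_grothendieck (complex_scalars R)).
Qed.
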